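(* Let $X$ be an infinite-dimensional complex Banach space and $T\in L(X)$. (1) $\partial\sigma_*(T)\subset\partial\sigma_{TUD}(T)$ for $\sigma_*\in\{\sigma_{B\mathcal{W}_+},\sigma_{B\mathcal{W}},\sigma_{LD}^e,\sigma_{dsc}^e,\sigma_{B\Phi},\sigma_{LD},\sigma_{dsc},\sigma_D\}$; (2) $\partial\sigma_*(T)\subset\partial\sigma_{q\Phi}(T)$ for $\sigma_*\in\{\sigma_{B\mathcal{W}_-},\sigma_{RD},\sigma_{RD}^e\}$.
   Context: $L(X)$ is the algebra of bounded linear operators on $X$; $N(T)$, $R(T)$ are the null space and range; $\alpha(T)=\dim N(T)$, $\beta(T)=\operatorname{codim}R(T)$; $\mathbb{N}_0=\{0,1,2,\dots\}$; $\inf\emptyset=\infty$; $\partial K$ is the boundary of $K\subset\mathbb{C}$. Ascent $a(T)=\inf\{n\in\mathbb{N}_0:N(T^n)=N(T^{n+1})\}$; descent $\delta(T)=\inf\{n\in\mathbb{N}_0:R(T^n)=R(T^{n+1})\}$; essential ascent $a_e(T)=\inf\{n\in\mathbb{N}_0:\dim N(T^{n+1})/N(T^n)<\infty\}$; essential descent $\delta_e(T)=\inf\{n\in\mathbb{N}_0:\dim R(T^n)/R(T^{n+1})<\infty\}$. $T$ is left Drazin invertible if $a(T)<\infty$ and $R(T^{a(T)+1})$ is closed; right Drazin invertible if $\delta(T)<\infty$ and $R(T^{\delta(T)})$ is closed; Drazin invertible if $a(T)<\infty$ and $\delta(T)<\infty$; left essentially Drazin invertible if $a_e(T)<\infty$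 and $R(T^{a_e(T)+1})$ is closed; right essentially Drazin invertible if $\delta_e(T)<\infty$ and $R(T^{\delta_e(T)})$ is closed. The corresponding spectra (sets of $\lambda\in\mathbb{C}$ for which $T-\lambda I$ fails the property) are $\sigma_{LD}(T),\sigma_{RD}(T),\sigma_D(T),\sigma_{LD}^e(T),\sigma_{RD}^e(T)$. Also $\sigma_{dsc}(T)=\{\lambda:\delta(T-\lambda I)=\infty\}$, $\sigma_{dsc}^e(T)=\{\lambda:\delta_e(T-\lambda I)=\infty\}$. An operator $S$ on a complex Banach space is upper semi-Fredholm if $\alpha(S)<\infty$ and $R(S)$ is closed, lower semi-Fredholm if $\beta(S)<\infty$, Fredholm if both; $\operatorname{ind}(S)=\alpha(S)-\beta(S)$. Let $T_n$ be the restriction of $T$ to $R(T^n)$ as a map $R(T^n)\to R(T^n)$. $T$ is B-Fredholm (resp. upper, lower semi-B-Fredholm) if for some $n\in\mathbb{N}_0$, $R(T^n)$ is closed and $T_n$ is Fredholm (resp. upper, lower semi-Fredholm); then $\operatorname{ind}(T):=\operatorname{ind}(T_n)$, independent of such $n$. $T$ is B-Weyl if it is B-Fredholm with $\operatorname{ind}(T)=0$; upper semi-B-Weyl if upper semi-B-Fredholm with $\operatorname{ind}(T)\le0$; lower semi-B-Weyl if lower semi-B-Fredholm with $\operatorname{ind}(T)\ge0$. The spectra for B-Fredholm, B-Weyl, upper semi-B-Weyl, lower semi-B-Weyl operators are $\sigma_{B\Phi}(T),\sigma_{B\mathcal{W}}(T),\sigma_{B\mathcal{W}_+}(T),\sigma_{B\mathcal{W}_-}(T)$.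 Let $k_n(T)=\dim (R(T^n)\cap N(T))/(R(T^{n+1})\cap N(T))$. $T$ is quasi-Fredholm if there is $d\in\mathbb{N}_0$ with $k_n(T)=0$ for all $n\ge d$ and $R(T^{d+1})$ closed. $T$ has topological uniform descent (TUD) if there is $d\in\mathbb{N}_0$ with $k_n(T)=0$ for all $n\ge d$ and, for all $n\ge d$, $R(T^n)$ closed in $R(T^d)$ with respect to the norm $\|y\|_d=\inf\{\|x\|:x\in X,\ y=T^dx\}$. The sets of $\lambda$ for which $T-\lambda I$ is not quasi-Fredholm, does not have TUD are $\sigma_{q\Phi}(T),\sigma_{TUD}(T)$. *)

(* Defs.v *)
From HB Require Import structures.
From mathcomp Require Import all_boot all_order all_algebra.
From mathcomp Require Import all_classical all_reals all_analysis.
From mathcomp Require Import complex.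

Set Implicit Arguments.
Unset Strict Implicit.
Unset Printing Implicit Defensive.

Import Order.TTheory GRing.Theory Num.Theory.
Import numFieldNormedType.Exports.

Local Open Scope classical_set_scope.
Local Open Scope ring_scope.
Local Open Scope complex_scope.

Definition boundary (T : topologicalType) (K : set T) : set T :=
  closure K `\` interior K.

(* Infimum in N_0 \cup {oo}; None stands for oo, so that inf set0 = oo. *)
Definition nat_inf (P : set nat) : option nat :=
  match pselect (exists n, `[< P n >]) with
  | left exP => Some (ex_minn exP)
  | right _ => None
  end.

Definition enat (o : option nat) : \bar int :=
  if o is Some n then EFin n%:Z else +oo%E.

Section QuotientDimension.
Context (K : fieldType) (V : lmodType K).
Implicit Types M N : set V.

(* For subspaces N `<=` M, the classes of the v i form a basis of M / N. *)
Definition is_basis_mod M N n (v : 'I_n -> V) : Prop :=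
  (forall i, M (v i)) /\
  (forall x, M x -> exists! c : 'rV[K]_n, N (x - \sum_(i < n) c 0 i *: v i)).

Definition qdim M N : option nat :=
  nat_inf [set n | exists v : 'I_n -> V, is_basis_mod M N v].

End QuotientDimension.

Definition infinite_dimensional (K : fieldType) (V : lmodType K) : Prop :=
  qdim [set: V] [set 0] = None.

(* Operators are plain functions X -> X; linearity and continuity are assumed
   where these notions are used. *)
Section Operators.
Context (R : realType) (X : normedModType R[i]).
Implicit Types (T S : X -> X) (M A : set X) (n d : nat).

Definition nullsp T n : set X := [set x | iter n T x = 0].
Definition rangesp T n : set X := range (iter n T).

Definition ascent T : option nat :=
  nat_inf [set n | nullsp T n = nullsp T n.+1].
Definition descent T : option nat :=
  nat_inf [set n | rangesp T n = rangesp T n.+1].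
Definition ess_ascent T : option nat :=
  nat_inf [set n | qdim (nullsp T n.+1) (nullsp T n) <> None].
Definition ess_descent T : option nat :=
  nat_inf [set n | qdim (rangesp T n) (rangesp T n.+1) <> None].

Definition left_drazin T : Prop :=
  exists2 p, ascent T = Some p & closed (rangesp T p.+1).
Definition right_drazin T : Prop :=
  exists2 p, descent T = Some p & closed (rangesp T p).
Definition drazin T : Prop := ascent T <> None /\ descent T <> None.
Definition left_ess_drazin T : Prop :=
  exists2 p, ess_ascent T = Some p & closed (rangesp T p.+1).
Definition right_ess_drazin T : Prop :=
  exists2 p, ess_descent T = Some p & closed (rangesp T p).
Definition finite_descent T : Prop := descent T <> None.
Definition finite_ess_descent T : Prop := ess_descent T <> None.

(* Fredholm theory of the restriction S : M -> M to an S-invariant subspace M;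
   M = setT gives the theory of S itself. *)
Definition nullity M S : option nat :=
  qdim (M `&` [set x | S x = 0]) [set 0].
Definition defect M S : option nat := qdim M (S @` M).

Definition upper_semi_fredholm M S : Prop :=
  nullity M S <> None /\ closed (S @` M : set (subspace M)).
Definition lower_semi_fredholm M S : Prop := defect M S <> None.
Definition fredholm M S : Prop :=
  upper_semi_fredholm M S /\ lower_semi_fredholm M S.
Definition semi_fredholm M S : Prop :=
  upper_semi_fredholm M S \/ lower_semi_fredholm M S.

Definition index M S : \bar int :=
  (enat (nullity M S) - enat (defect M S))%E.

Definition upper_semi_B_fredholm T : Prop :=
  exists2 n, closed (rangesp T n) & upper_semi_fredholm (rangesp T n) T.
Definition lower_semi_B_fredholm T : Prop :=
  exists2 n, closed (rangesp T n) & lower_semi_fredholm (rangesp T n) T.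
Definition B_fredholm T : Prop :=
  exists2 n, closed (rangesp T n) & fredholm (rangesp T n) T.

(* The index of T_n is the same for all n such that R(T^n) is closed and T_n is
   semi-Fredholm; the least such n is used. The value 0 is a dummy for
   operators that are not semi-B-Fredholm. *)
Definition B_index T : \bar int :=
  if nat_inf [set n | closed (rangesp T n) /\ semi_fredholm (rangesp T n) T]
    is Some n then index (rangesp T n) T else 0%E.

Definition B_weyl T : Prop := B_fredholm T /\ B_index T = 0%E.
Definition upper_semi_B_weyl T : Prop :=
  upper_semi_B_fredholm T /\ (B_index T <= 0)%E.
Definition lower_semi_B_weyl T : Prop :=
  lower_semi_B_fredholm T /\ (0 <= B_index T)%E.

Definition kdim T n : option nat :=
  qdim (rangesp T n `&` nullsp T 1) (rangesp T n.+1 `&` nullsp T 1).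

Definition quasi_fredholm T : Prop :=
  exists d, (forall n, (d <= n)%N -> kdim T n = Some 0%N) /\
            closed (rangesp T d.+1).

(* Norms of X are R[i]-valued (with zero imaginary part), hence the Re. *)
Definition range_norm T d (y : X) : R :=
  inf [set complex.Re `|x| | x in [set x | y = iter d T x]].

Definition closed_in_norm (nu : X -> R) M A : Prop :=
  forall y, M y ->
    (forall e : R, 0 < e -> exists2 z, A z & nu (y - z) < e) -> A y.

Definition TUD T : Prop :=
  exists d, (forall n, (d <= n)%N -> kdim T n = Some 0%N) /\
    (forall n, (d <= n)%N ->
       closed_in_norm (range_norm T d) (rangesp T d) (rangesp T n)).

(* The complex plane is R[i]^o: the topology is attached to this alias. *)
Definition spectrum_of (P : (X -> X) -> Prop) T : set R[i]^o :=
  [set lambda | ~ P (fun x => T x - (lambda : R[i]) *: x)].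

Definition sigma_LD := spectrum_of left_drazin.
Definition sigma_RD := spectrum_of right_drazin.
Definition sigma_D := spectrum_of drazin.
Definition sigma_LDe := spectrum_of left_ess_drazin.
Definition sigma_RDe := spectrum_of right_ess_drazin.
Definition sigma_dsc := spectrum_of finite_descent.
Definition sigma_dsce := spectrum_of finite_ess_descent.
Definition sigma_BPhi := spectrum_of B_fredholm.
Definition sigma_BW := spectrum_of B_weyl.
Definition sigma_BWplus := spectrum_of upper_semi_B_weyl.
Definition sigma_BWminus := spectrum_of lower_semi_B_weyl.
Definition sigma_qPhi := spectrum_of quasi_fredholm.
Definition sigma_TUD := spectrum_of TUD.

End Operators.

(* Main.v *)
Require Import Defs.
From HB Require Import structures.
From mathcomp Require Import all_boot all_order all_algebra.
From mathcomp Require Import all_classical all_reals all_analysis.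
From mathcomp Require Import complex ring lra.
Import Order.TTheory GRing.Theory Num.Theory.
Import numFieldNormedType.Exports.
Local Open Scope classical_set_scope.
Local Open Scope ring_scope.
Local Open Scope complex_scope.

(** Write [a_n = dim N(T) /\ R(T^n)] and [b_n = dim R(T^n) / R(T^(n+1))]. Both
    drop by [k_n] from [n] to [n + 1], so under uniform descent they are
    eventually constant, with values [a] and [b] in [{0, 1, ..., oo}]. Under
    uniform descent (for the last three classes, for quasi-Fredholm operators)
    each of the eleven properties turns out to be a condition on [a] and [b]
    alone: [a] or [b] is finite, or zero, or the index [a - b] is zero or has a
    sign. The ranges which have to be closed are so automatically: this is
    Neubauer's lemma [neubauer], a consequence of the open mapping theorem.

    The theorem then follows from two facts. First, each property implies
    uniform descent (resp. quasi-Fredholmness), so the spectrum for the latter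
    is contained in the spectrum for the former, and so are the interiors.
    Secondly, if [T - l] has uniform descent, then so does [T - m] for all [m]
    close to [l], and with the same [a] and [b] ([punctured_neighbourhood]);
    hence the property holds either at all points close to [l] or at none,
    and [l] is not a boundary point of its spectrum ([boundary_sub]).

    To prove the second fact at [l = 0], let [N = N(T^d)] and let [Z] be the
    preimage under [T^d] of the intersection of the [R(T^n)]. Uniform descent
    makes [T] semi-regular modulo [N]: its range is closed modulo [N], and
    [Z] contains [N], satisfies [T^-1 Z = Z] and lies in [R(T) + N]. By the
    open mapping theorem [T] has lifts bounded by a constant [C], modulo [N].
    For [C |m| <= 1/2] the operator [T - m] maps [Z] onto itself modulo [N] and
    is bounded below modulo [Z], with constants that do not depend on [m]. So a
    Riesz basis of the kernel, or of a complement of the range, at [m'] can be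
    moved to one at [m] if [m - m'] is small with respect to the dimension;
    small steps then lead from [0] to [m]. Finally [T - m] is bijective on [N]
    for [m != 0], so that for the actual kernel and range nothing is lost
    by working modulo [N]. *)

Set Implicit Arguments.
Unset Strict Implicit.
Unset Printing Implicit Defensive.

(** * Reflexive decision of identities in abelian groups *)

(** An identity holds if its two sides have the same integer coefficient on
    each atom; expressions are reified to compare these by computation. *)
Inductive zexpr := ZVar of nat | ZAdd of zexpr & zexpr | ZOpp of zexpr | ZZero.

Section ZExpr.
Context {V : zmodType}.
Implicit Types (e : zexpr) (env : seq V).

Fixpoint zeval env e : V := match e with
  | ZVar i => nth 0 env i
  | ZAdd e1 e2 => zeval env e1 + zeval env e2
  | ZOpp e1 => - zeval env e1
  | ZZero => 0 end.

Fixpoint zcoef e (i : nat) : int := match e with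
  | ZVar j => (i == j)%:Z
  | ZAdd e1 e2 => zcoef e1 i + zcoef e2 i
  | ZOpp e1 => - zcoef e1 i
  | ZZero => 0 end.

Lemma zevalE env e : zeval env e = \sum_(i < size env) env`_i *~ zcoef e i.
Proof.
elim: e => [j|e1 IH1 e2 IH2|e1 IH1|] /=.
- have [js|js] := ltnP j (size env).
    rewrite (bigD1 (Ordinal js)) //= eqxx mulr1z big1 ?addr0 // => i.
    by rewrite -val_eqE /= => /negPf ->; rewrite mulr0z.
  rewrite nth_default // big1 // => i _.
  by rewrite (ltn_eqF (leq_trans (ltn_ord i) js)) mulr0z.
- by rewrite IH1 IH2 -big_split; apply: eq_bigr => i _; rewrite mulrzDr.
- by rewrite IH1 -sumrN; apply: eq_bigr => i _; rewrite mulrNz.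
- by rewrite big1 // => i _; rewrite mulr0z.
Qed.

Lemma zexpr_eq env e1 e2 :
  all (fun i => zcoef e1 i == zcoef e2 i) (iota 0 (size env)) ->
  zeval env e1 = zeval env e2.
Proof.
move=> /allP h; rewrite !zevalE; apply: eq_bigr => i _.
by rewrite (eqP (h i _)) // mem_iota add0n /=.
Qed.

End ZExpr.

(* Atoms are compared up to conversion: the same term may occur with different
   canonical structures in its implicit arguments. *)
Ltac zindex t env := match env with
  | ?u :: _ => let _ := match goal with _ => unify u t end in constr:(0%N)
  | _ :: ?l => let i := zindex t l in constr:(S i)
  end.

Ltac zatoms t env := match t with
  | (?a + ?b)%R => let env1 := zatoms a env in zatoms b env1
  | (- ?a)%R => zatoms a env
  | 0%R => env
  | _ => match env with
    | _ => let _ := zindex t env in env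
    | _ => constr:(t :: env)
    end
  end.

Ltac zquote t env := match t with
  | (?a + ?b)%R =>
    let u := zquote a env in let v := zquote b env in constr:(ZAdd u v)
  | (- ?a)%R => let u := zquote a env in constr:(ZOpp u)
  | 0%R => constr:(ZZero)
  | _ => let i := zindex t env in constr:(ZVar i)
  end.

Ltac zabel := match goal with
  | |- @eq ?T ?a ?b =>
    let env := zatoms a (@nil T) in
    let env := zatoms b env in
    let ea := zquote a env in let eb := zquote b env in
    exact: (@zexpr_eq _ env ea eb isT)
  end.

(** * Dimensions of quotients of subspaces *)

Section Dimension.
Context {K : fieldType} {V : lmodType K}.
Implicit Types (M N P : set V) (v w : nat -> V) (c : nat -> K) (m k : nat).

Definition subspc M := M 0 /\ forall a x y, M x -> M y -> M (a *: x + y).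

Lemma subspc0 M : subspc M -> M 0. Proof. by case. Qed.

Lemma subspcD M x y : subspc M -> M x -> M y -> M (x + y).
Proof. by move=> [_ h] Mx My; rewrite -[x]scale1r; apply: h. Qed.

Lemma subspcZ M a x : subspc M -> M x -> M (a *: x).
Proof. by move=> [h0 h] Mx; rewrite -[_ *: _]addr0; apply: h. Qed.

Lemma subspcN M x : subspc M -> M x -> M (- x).
Proof. by move=> sM Mx; rewrite -scaleN1r; apply: subspcZ. Qed.

Lemma subspcB M x y : subspc M -> M x -> M y -> M (x - y).
Proof. by move=> sM Mx My; apply: subspcD => //; apply: subspcN. Qed.

Lemma subspc_sum M m c v : subspc M -> (forall i, (i < m)%N -> M (v i)) ->
  M (\sum_(i < m) c i *: v i).
Proof.
move=> sM Mv; elim: m Mv => [|m IH] Mv; first by rewrite big_ord0; case: sM.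
rewrite big_ord_recr /=; apply: subspcD => //; last by apply: subspcZ => //; apply: Mv.
by apply: IH => i im; apply: Mv; rewrite ltnW.
Qed.

Definition indep_mod N m v := forall c, N (\sum_(i < m) c i *: v i) ->
  forall i, (i < m)%N -> c i = 0.

Definition span_mod M N m v := forall x, M x ->
  exists c, N (x - \sum_(i < m) c i *: v i).

(** Lower bounds for [dim M / N] make sense for infinite dimensions too, and
    determine the dimension: see [dimgeP] and [qdim_ext]. *)
Definition dimge M N m :=
  exists2 v, forall i, (i < m)%N -> M (v i) & indep_mod N m v.

(** Steinitz exchange, through the kernel of a [k x m] coordinate matrix. *)
Lemma steinitz N k m v w : subspc N -> indep_mod N k v ->
  (forall i, (i < k)%N -> exists c, N (v i - \sum_(j < m) c j *: w j)) ->
  (k <= m)%N.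
Proof.
move=> sN iv sw; rewrite leqNgt; apply/negP => mk.
have [A hA] : exists A : 'M[K]_(k, m),
    forall i : 'I_k, N (v i - \sum_(j < m) A i j *: w j).
  have /(_ _)/cid h i : exists c, N (v (i : 'I_k) - \sum_(j < m) c j *: w j).
    exact: sw.
  exists (\matrix_(i, j) sval (h i) j) => i.
  by under eq_bigr do rewrite mxE; exact: svalP (h i).
have : kermx A != 0.
  rewrite kermx_eq0 /row_free neq_ltn; apply/orP; left.
  by apply: leq_ltn_trans mk; exact: rank_leq_col.
move=> /eqP; apply; apply/matrixP => a i.
pose r := row a (kermx A).
have rA : r *m A = 0 by rewrite /r -row_mul mulmx_ker row0.
pose c j := if insub j is Some j' then r 0 j' else 0 : K.
have cE (j : 'I_k) : c j = r 0 j by rewrite /c valK.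
have /(iv c)/(_ i (ltn_ord i)) : N (\sum_(j < k) c j *: v j).
  have -> : \sum_(j < k) c j *: v j =
      \sum_(j < k) c j *: (v j - \sum_(l < m) A j l *: w l).
    under [in RHS]eq_bigr do rewrite scalerBr.
    rewrite sumrB; apply/esym/eqP; rewrite subr_eq addrC -subr_eq subrr eq_sym.
    apply/eqP; under eq_bigr do rewrite scaler_sumr.
    rewrite exchange_big /= big1 // => l _.
    under eq_bigr do rewrite scalerA cE.
    rewrite -scaler_suml.
    by move/matrixP: rA => /(_ 0 l); rewrite !mxE => ->; rewrite scale0r.
  pose u j := if insub j is Some j' then
    v (j' : 'I_k) - \sum_(l < m) A j' l *: w l else 0.
  have uE (j : 'I_k) : u j = v j - \sum_(l < m) A j l *: w l.
    by rewrite /u valK.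
  have : N (\sum_(j < k) c j *: u j).
    by apply: subspc_sum => // j jk; rewrite (uE (Ordinal jk)); apply: hA.
  by under eq_bigr do rewrite uE.
by rewrite cE /r mxE => ->; rewrite mxE.
Qed.

Lemma qdim_Some M N m : subspc N ->
  qdim M N = Some m <->
  exists v, [/\ forall i, (i < m)%N -> M (v i), indep_mod N m v
                & span_mod M N m v].
Proof.
move=> sN.
have key n : (exists v : 'I_n -> V, is_basis_mod M N v) <->
  exists v, [/\ forall i, (i < n)%N -> M (v i), indep_mod N n v
                & span_mod M N n v].
  split=> [[v [Mv bv]]|[v [Mv iv sv]]].
    pose v' i := if insub i is Some i' then v i' else 0.
    have v'E (i : 'I_n) : v' i = v i by rewrite /v' valK.
    exists v'; split.
    - by move=> i im; rewrite /v' insubT.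
    - move=> c Nc i im.
      have M0 : N 0 by case: sN.
      (* subtracting the relation [c] from the coordinates [d] of [v i] gives
         coordinates of [v i] again *)
      have [d [Nd ud]] := bv _ (Mv (Ordinal im)).
      have h : d = d - \row_j c j.
        apply: ud; under eq_bigr do rewrite !mxE scalerBl.
        rewrite sumrB opprB addrA addrAC; apply: subspcD => //.
        by under eq_bigr do rewrite -v'E.
      move/matrixP: h => /(_ 0 (Ordinal im)); rewrite !mxE /= => /eqP.
      by rewrite -subr_eq0 opprB addrC subrK => /eqP.
    - move=> x /bv [d [Nd _]].
      exists (fun i => if insub i is Some i' then d 0 i' else 0).
      by under eq_bigr do rewrite valK v'E.
  exists (fun i => v i); split=> [i|x Mx]; first exact: Mv.
  have [c Nc] := sv x Mx.
  exists (\row_j c j); split; first by under eq_bigr do rewrite mxE.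
  move=> d Nd; apply/matrixP => i j; rewrite mxE ord1.
  pose e i := if insub i is Some i' then d 0 i' else 0 : K.
  have eE (i' : 'I_n) : e i' = d 0 i' by rewrite /e valK.
  have /(iv (fun i => c i - e i))/(_ j (ltn_ord j))/eqP :
      N (\sum_(i < n) (c i - e i) *: v i).
    under eq_bigr do rewrite scalerBl eE.
    rewrite sumrB.
    have := subspcB sN Nd Nc; rewrite opprB addrC addrA addrNK.
    by rewrite addrC.
  by rewrite eE subr_eq0 => /eqP.
rewrite -key /qdim /nat_inf; case: pselect => [exP|nP].
  case: ex_minnP => n /asboolP nb nmin; split=> [[<-]//|mb].
  have -> // : n = m.
  have [v [Mv iv sv]] := (key n).1 nb.
  have [w [Mw iw sw]] := (key m).1 mb.
  apply/eqP; rewrite eqn_leq; apply/andP; split.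
    by apply: nmin; apply/asboolP.
  by apply: (steinitz sN iw) => i im; apply/sv/Mw.
by split=> // hm; case: nP; exists m; apply/asboolP.
Qed.

Lemma dimge0 M N : dimge M N 0.
Proof. by exists (fun=> 0). Qed.

Lemma dimge_extend M N m v x : subspc N -> (forall i, (i < m)%N -> M (v i)) ->
  indep_mod N m v -> M x -> (forall c, ~ N (x - \sum_(i < m) c i *: v i)) ->
  dimge M N m.+1.
Proof.
move=> sN Mv iv Mx nx; pose u i := if (i < m)%N then v i else x.
have uE c : \sum_(i < m.+1) c i *: u i = \sum_(i < m) c i *: v i + c m *: x.
  rewrite big_ord_recr /= /u ltnn; congr (_ + _).
  by apply: eq_bigr => i _; rewrite ltn_ord.
exists u; first by move=> i _; rewrite /u; case: ifPn => //; exact: Mv.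
move=> c; rewrite uE => Nc.
have cm0 : c m = 0.
  apply/eqP/negPn/negP => cm; apply: (nx (fun i => - (c m)^-1 * c i)).
  under eq_bigr do rewrite -scalerA.
  rewrite -scaler_sumr scaleNr opprK -[x]scale1r -(mulVf cm) -scalerA.
  by rewrite -scalerDr addrC; apply: subspcZ.
move: Nc; rewrite cm0 scale0r addr0 => /iv h i.
by rewrite ltnS leq_eqVlt => /orP[/eqP ->|/h].
Qed.

Lemma dimge_leq M N m k : (k <= m)%N -> dimge M N m -> dimge M N k.
Proof.
move=> km [v Mv iv]; exists v.
  by move=> i ik; apply: Mv; exact: leq_trans ik km.
move=> c Nc i ik.
pose c' i := if (i < k)%N then c i else 0.
suff /iv/(_ i (leq_trans ik km)) : N (\sum_(i < m) c' i *: v i).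
  by rewrite /c' ik.
rewrite (eq_bigr (fun i : 'I_m => if (i < k)%N then c i *: v i else 0)).
  rewrite -big_mkcond /=.
  by rewrite -(big_ord_widen _ (fun i => c i *: v i) km).
by move=> j _; rewrite /c'; case: ifP; rewrite ?scale0r.
Qed.

Lemma qdim_None M N : subspc N -> qdim M N = None -> forall m, dimge M N m.
Proof.
move=> sN qN; elim=> [|m [v Mv iv]]; first exact: dimge0.
have [[x [Mx nx]]|h] := pselect (exists x, M x /\
    forall c, ~ N (x - \sum_(i < m) c i *: v i)).
  exact: dimge_extend nx.
suff : qdim M N = Some m by rewrite qN.
apply/qdim_Some => //; exists v; split=> // x Mx.
by apply: contrapT => nc; apply: h; exists x; split=> // c Nc; apply: nc; exists c.
Qed.

Lemma dimgeP M N m : subspc N ->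
  dimge M N m <-> if qdim M N is Some k then (m <= k)%N else True.
Proof.
move=> sN; case E: (qdim M N) => [k|].
  have [v [Mv iv sv]] := (qdim_Some M k sN).1 E.
  split=> [[w Mw iw]|mk]; last by apply: (dimge_leq mk); exists v.
  by apply: (steinitz sN iw) => i im; apply/sv/Mw.
by split=> // _; apply: qdim_None.
Qed.

Lemma qdim_finite M N m w : subspc N ->
  span_mod M N m w -> qdim M N <> None.
Proof.
move=> sN sw /(qdim_None sN)/(_ m.+1) [v Mv iv].
suff : (m.+1 <= m)%N by rewrite ltnn.
by apply: (steinitz sN iv) => i im; apply/sw/Mv.
Qed.

Lemma qdim_eq0 M N : subspc N -> qdim M N = Some 0%N <-> M `<=` N.
Proof.
move=> sN; rewrite qdim_Some //; split=> [[v [_ _ sv]] x /sv [c]|MN].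
  by rewrite big_ord0 subr0.
by exists (fun=> 0); split=> // x /MN Nx; exists (fun=> 0); rewrite big_ord0 subr0.
Qed.

End Dimension.

Lemma qdim_ext (K : fieldType) (V V' : lmodType K) (M N : set V)
    (M' N' : set V') : subspc N -> subspc N' ->
  (forall m, dimge M N m <-> dimge M' N' m) -> qdim M N = qdim M' N'.
Proof.
move=> sN sN' h.
have {}h m : (if qdim M N is Some k then (m <= k)%N : Prop else True) <->
             (if qdim M' N' is Some k then (m <= k)%N : Prop else True).
  by rewrite -!dimgeP.
case: (qdim M N) h => [k|]; case: (qdim M' N') => [k'|] // h.
- congr Some; apply/eqP; rewrite eqn_leq.
  by rewrite (h k).1 //= (h k').2.
- by have := (h k.+1).2 I; rewrite ltnn.
- by have := (h k'.+1).1 I; rewrite ltnn.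
Qed.

(** The hypotheses mean that [f] induces an isomorphism [M / N -> M' / N']. *)
Lemma qdim_iso (K : fieldType) (V V' : lmodType K) (f : {linear V -> V'})
    (M N : set V) (M' N' : set V') :
  subspc M -> subspc N -> subspc N' -> (forall x, M x -> M' (f x)) ->
  (forall x, M x -> N x <-> N' (f x)) ->
  (forall y, M' y -> exists2 x, M x & N' (y - f x)) ->
  qdim M N = qdim M' N'.
Proof.
move=> sM sN sN' fM fN fs; apply: qdim_ext => // m; split=> [[v Mv iv]|].
  exists (fun i => f (v i)); first by move=> i im; apply/fM/Mv.
  move=> c Nc; apply: iv.
  have Mc : M (\sum_(i < m) c i *: v i) by exact: (subspc_sum c sM Mv).
  apply/(fN _ Mc).
  by rewrite linear_sum; under eq_bigr do rewrite linearZ.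
move=> [v Mv iv].
have /choice [u hu] i : exists u, (i < m)%N -> M u /\ N' (v i - f u).
  have [im|] := boolP (i < m)%N; last by exists 0.
  by have [u Mu Nu] := fs _ (Mv i im); exists u.
exists u; first by move=> i im; have [] := hu i im.
move=> c Nc; apply: iv.
have Mc : M (\sum_(i < m) c i *: u i).
  by apply: (subspc_sum c sM) => i im; have [] := hu i im.
move/(fN _ Mc): Nc; rewrite linear_sum; under eq_bigr do rewrite linearZ /=.
move=> N1.
have N2 : N' (\sum_(i < m) c i *: (v i - f (u i))).
  by apply: (@subspc_sum _ _ _ m c (fun i => v i - f (u i))) => // i im;
     have [] := hu i im.
have := subspcD sN' N1 N2; rewrite -big_split /=.
by under eq_bigr do rewrite -scalerDr addrC subrK.
Qed.

(** Addition in [{0, 1, ..., oo}], with [None] for [oo]. *)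
Definition oadd (a b : option nat) : option nat :=
  if a is Some m then if b is Some n then Some (m + n)%N else None else None.

(** A basis of [M / P] followed by a basis of [P / N] is a basis of [M / N]. *)
Lemma qdim_add (K : fieldType) (V : lmodType K) (M P N : set V) :
  subspc P -> subspc N -> N `<=` P -> P `<=` M ->
  qdim M N = oadd (qdim M P) (qdim P N).
Proof.
move=> sP sN NP PM.
have inf1 : qdim M P = None -> qdim M N = None.
  move=> /(qdim_None sP) h; case E: (qdim M N) => [k|] //.
  have [v Mv iv] := h k.+1; have : dimge M N k.+1.
    by exists v => // c /NP/iv.
  by move/(dimgeP _ _ sN); rewrite E ltnn.
have inf2 : qdim P N = None -> qdim M N = None.
  move=> /(qdim_None sN) h; case E: (qdim M N) => [k|] //.
  have [v Mv iv] := h k.+1; have : dimge M N k.+1.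
    by exists v => // i /Mv/PM.
  by move/(dimgeP _ _ sN); rewrite E ltnn.
case EP: (qdim M P) => [a|]; last by rewrite inf1.
case EN: (qdim P N) => [b|]; last by rewrite inf2.
have [v [Mv iv sv]] := (qdim_Some _ _ sP).1 EP.
have [w [Pw iw sw]] := (qdim_Some _ _ sN).1 EN.
pose u i := if (i < a)%N then v i else w (i - a)%N.
have uE (c : nat -> K) : \sum_(i < a + b) c i *: u i =
    \sum_(i < a) c i *: v i + \sum_(i < b) c (a + i)%N *: w i.
  rewrite big_split_ord /=; congr (_ + _); apply: eq_bigr => i _.
    by rewrite /u ltn_ord.
  by rewrite /u ltnNge leq_addr /= addKn.
have Psum (c : nat -> K) : P (\sum_(i < b) c (a + i)%N *: w i).
  by apply: (@subspc_sum _ _ _ b (fun i => c (a + i)%N) w sP Pw).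
apply/qdim_Some => //; exists u; split.
- move=> i iab; rewrite /u; case: ifPn => [/Mv//|]; rewrite -leqNgt => ai.
  by apply/PM/Pw; rewrite ltn_subLR.
- move=> c; rewrite uE => Nc.
  have ca : forall i, (i < a)%N -> c i = 0.
    by apply: iv; have := subspcB sP (NP _ Nc) (Psum c); rewrite addrK.
  move: Nc; rewrite big1 ?add0r => [/(iw (fun i => c (a + i)%N)) cb i iab|].
    have [/ca//|ai] := ltnP i a.
    by have := cb (i - a)%N; rewrite ltn_subLR // subnKC //; exact.
  by move=> i _; rewrite ca ?scale0r.
- move=> x /sv [c Pc]; have [d Nd] := sw _ Pc.
  pose e i := if (i < a)%N then c i else d (i - a)%N; exists e.
  rewrite (uE e) opprD addrA.
  under eq_bigr do rewrite /e ltn_ord.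
  by under [X in _ - _ - X]eq_bigr do rewrite /e ltnNge leq_addr /= addKn.
Qed.

(** * Real-valued norms and closed subspaces *)

Section RealNorm.
Context {R : realType} {X : normedModType R[i]}.
Implicit Types (x y : X) (a : R[i]) (A B : set X) (e : R).

(** Norms on [X] take values in [R[i]], where the order is partial; their real
    parts lose nothing. *)
Definition nm x : R := complex.Re `|x|.
Definition cn a : R := complex.Re `|a|.

Lemma complex_ge0 (z : R[i]) : 0 <= z -> z = (complex.Re z)%:C.
Proof. by case: z => u v; rewrite lecE /= => /andP[/eqP -> _]. Qed.

Lemma nmE x : `|x| = (nm x)%:C.
Proof. exact: complex_ge0. Qed.

Lemma cnE a : `|a| = (cn a)%:C.
Proof. by apply: complex_ge0; exact: normr_ge0. Qed.

Lemma leC (u v : R) : (u%:C <= v%:C :> R[i]) = (u <= v).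
Proof. by rewrite lecE /= eqxx. Qed.

Lemma ltC (u v : R) : (u%:C < v%:C :> R[i]) = (u < v).
Proof. by rewrite ltcE /= eqxx. Qed.

Lemma nm_ge0 x : 0 <= nm x.
Proof. by rewrite -leC -nmE normr_ge0. Qed.

Lemma cn_ge0 a : 0 <= cn a.
Proof. by rewrite -leC -cnE normr_ge0. Qed.

Lemma nmD x y : nm (x + y) <= nm x + nm y.
Proof. by rewrite -leC rmorphD /= -!nmE ler_normD. Qed.

Lemma nmN x : nm (- x) = nm x.
Proof. by rewrite /nm normrN. Qed.

Lemma nmB x y : nm (x - y) <= nm x + nm y.
Proof. by rewrite -(nmN y) nmD. Qed.

Lemma nmZ a x : nm (a *: x) = cn a * nm x.
Proof.
have : (nm (a *: x))%:C = (cn a * nm x)%:C.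
  by rewrite rmorphM /= -nmE -cnE -nmE normrZ.
by case.
Qed.

Lemma nm0 : nm 0 = 0. Proof. by rewrite /nm normr0. Qed.

Lemma nm_eq0 x : (nm x == 0) = (x == 0).
Proof.
rewrite -[RHS]normr_eq0 nmE; apply/eqP/eqP => [->//|].
by case.
Qed.

Lemma nm_gt0 x : (0 < nm x) = (x != 0).
Proof. by rewrite lt_neqAle nm_ge0 andbT eq_sym nm_eq0. Qed.

Lemma nmBC x y : nm (x - y) = nm (y - x).
Proof. by rewrite -nmN opprB. Qed.

Lemma nm_tri y x z : nm (x - z) <= nm (x - y) + nm (y - z).
Proof. by rewrite -{1}[x](subrK y) -addrA nmD. Qed.

Lemma cn_real (r : R) : cn r%:C = `|r|.
Proof. by rewrite /cn normc_def /= expr0n /= addr0 sqrtr_sqr. Qed.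

Lemma cnM a b : cn (a * b) = cn a * cn b.
Proof.
have : (cn (a * b))%:C = (cn a * cn b)%:C by rewrite rmorphM /= -!cnE normrM.
by case.
Qed.

Lemma cn0 : cn 0 = 0. Proof. by rewrite /cn normr0. Qed.

Lemma cn_eq0 a : (cn a == 0) = (a == 0).
Proof.
rewrite -[RHS]normr_eq0 cnE; apply/eqP/eqP => [->//|].
by case.
Qed.

Lemma cnN a : cn (- a) = cn a. Proof. by rewrite /cn normrN. Qed.

Lemma nbhs_nmP x A :
  nbhs x A <-> exists2 e, 0 < e & forall y, nm (x - y) < e -> A y.
Proof.
split=> [/nbhs_ballP[e /= e0 eA]|[e e0 eA]].
  have eR := complex_ge0 (ltW e0).
  exists (complex.Re e); first by rewrite -ltC -eR.
  by move=> y xy; apply: eA; rewrite -ball_normE /ball_ /= nmE eR ltC.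
apply/nbhs_ballP; exists e%:C => /=; first by rewrite ltC.
by move=> y; rewrite -ball_normE /ball_ /= nmE ltC; exact: eA.
Qed.

Lemma closureE A x :
  closure A x <-> forall e, 0 < e -> exists2 y, A y & nm (x - y) < e.
Proof.
split=> [cA e e0|h B /nbhs_nmP[e e0 eB]].
  have /cA [y [Ay xy]] : nbhs x [set y | nm (x - y) < e].
    by apply/nbhs_nmP; exists e.
  by exists y.
by have [y Ay xy] := h e e0; exists y; split=> //; exact: eB.
Qed.

Lemma closedE A :
  closed A <->
  forall x, (forall e, 0 < e -> exists2 y, A y & nm (x - y) < e) -> A x.
Proof.
split=> [cA x /closureE|h x /closureE]; first exact: cA.
exact: h.
Qed.

Lemma bounded_op (T : {linear X -> X}) : continuous T ->
  exists2 K : R, 0 < K & forall x, nm (T x) <= K * nm x.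
Proof.
move=> /linear_bounded_continuous/linear_boundedP/pinfty_ex_gt0[K K0 TK].
have KR := complex_ge0 (ltW K0).
exists (complex.Re K); first by rewrite -ltC -KR.
by move=> x; rewrite -leC rmorphM /= -KR -!nmE.
Qed.

End RealNorm.

Local Notation half := (2^-1).

Lemma half_small (R : realType) (c e : R) : 0 < e ->
  exists n : nat, c * half ^+ n < e.
Proof.
move=> e0; have [c0|c0] := leP c 0.
  by exists 0%N; rewrite expr0 mulr1 (le_lt_trans c0).
exists (Num.bound (c / e)); rewrite exprVn ltr_pdivrMr ?exprn_gt0 //.
rewrite mulrC -ltr_pdivrMr //; apply: (lt_le_trans (archi_boundP _)).
  by rewrite divr_ge0 ?ltW.
by rewrite -natrX ler_nat ltnW // ltn_expl.
Qed.

Lemma geo_complete (R : realType) (X : completeNormedModType R[i])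
    (u : nat -> X) (c : R) :
  (forall n, nm (u n.+1 - u n) <= c * half ^+ n) ->
  exists l, forall n, nm (l - u n) <= 2 * c * half ^+ n.
Proof.
move=> h.
have bd n k : nm (u (n + k)%N - u n) <= 2 * c * (half ^+ n - half ^+ (n + k)).
  elim: k => [|k IH]; first by rewrite addn0 !subrr mulr0 nm0.
  rewrite addnS (le_trans (nm_tri (u (n + k)%N) _ _)) //.
  rewrite (le_trans (lerD (h _) IH)) // exprS.
  set p := half ^+ (n + k); set q := half ^+ n.
  have : (2 : R) * half = 1 by rewrite divff.
  by move=> h2; nra.
have c0 : 0 <= c.
  by have := le_trans (nm_ge0 _) (h 0%N); rewrite expr0 mulr1.
have bd' n k : (n <= k)%N -> nm (u k - u n) <= 2 * c * half ^+ n.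
  move=> nk; rewrite -(subnKC nk); apply: le_trans (bd _ _) _.
  by rewrite ler_wpM2l ?mulr_ge0 // lerBlDr lerDl exprn_ge0.
have : cvg (u @ \oo).
  apply: cauchy_cvg; apply: cauchy_exP => e e0.
  have eR := complex_ge0 (ltW e0).
  have e0' : 0 < complex.Re e by rewrite -ltC -eR.
  have [n hn] := half_small (2 * c) e0'.
  exists (u n); exists n => // k /= nk.
  rewrite -ball_normE /ball_ /= nmE eR ltC nmBC.
  exact: le_lt_trans (bd' _ _ nk) hn.
move=> /cvg_ex[l ul]; exists l => n; apply/ler_addgt0Pr => e e0.
have /ul [N _ hN] : nbhs l [set y | nm (l - y) < e].
  by apply/nbhs_nmP; exists e.
have /= := hN (maxn N n) (leq_maxl _ _) => h1.
apply: le_trans (nm_tri (u (maxn N n)) _ _) _.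
by rewrite addrC lerD ?(ltW h1) // bd' // leq_maxr.
Qed.

(** The limit is the supremum of the lower bounds [u n - 2 c / 2^n]. *)
Lemma geo_complete_real (R : realType) (u : nat -> R) (c : R) :
  (forall n, `|u n.+1 - u n| <= c * half ^+ n) ->
  exists l, forall n, `|l - u n| <= 2 * c * half ^+ n.
Proof.
move=> h.
pose b n := 2 * c * half ^+ n : R.
have c0 : 0 <= c by have := le_trans (normr_ge0 _) (h 0%N); rewrite expr0 mulr1.
have bS n : u n.+1 - u n + b n.+1 <= b n /\ u n - u n.+1 + b n.+1 <= b n.
  have := h n; rewrite ler_norml => /andP[]; rewrite /b exprS.
  set p := half ^+ n; have h2 : (2 : R) * half = 1 by rewrite divff.
  by split; nra.
have lo n k : u n - b n <= u (n + k)%N - b (n + k)%N.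
  elim: k => [|k IH]; first by rewrite addn0.
  by rewrite addnS; have [] := bS (n + k)%N; lra.
have hi n k : u (n + k)%N + b (n + k)%N <= u n + b n.
  elim: k => [|k IH]; first by rewrite addn0.
  by rewrite addnS; have [] := bS (n + k)%N; lra.
have b0 n : 0 <= b n by rewrite /b !mulr_ge0 // exprn_ge0.
have lohi n k : u n - b n <= u k + b k.
  by have := lo n k; have := hi k n; have := b0 (n + k)%N; rewrite (addnC k n); lra.
pose S := range (fun n => u n - b n).
exists (sup S) => n; rewrite ler_distl; apply/andP; split.
  apply: ub_le_sup; last by exists n.
  by exists (u 0%N + b 0%N) => _ [k _ <-].
by apply: sup_le_ub => [|_ [k _ <-]//]; exists (u 0%N - b 0%N), 0%N.
Qed.

Section ClosedSubspaces.
Context {R : realType} {X : normedModType R[i]}.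
Implicit Types (N M P : set X).

Lemma cn_ReIm (z : R[i]) : `|complex.Re z| <= cn z /\ `|complex.Im z| <= cn z.
Proof.
case: z => a b; rewrite /cn normc_def /=; split.
  by rewrite -sqrtr_sqr ler_wsqrtr // lerDl sqr_ge0.
by rewrite -sqrtr_sqr ler_wsqrtr // lerDr sqr_ge0.
Qed.

Lemma cn_le_ReIm (z : R[i]) : cn z <= `|complex.Re z| + `|complex.Im z|.
Proof.
case: z => a b; rewrite /cn normc_def /=.
have h : 0 <= `|a| + `|b| by rewrite addr_ge0.
rewrite -[leRHS]ger0_norm // -sqrtr_sqr ler_wsqrtr //.
have ha : `|a| ^+ 2 = a ^+ 2 by rewrite real_normK ?num_real.
have hb : `|b| ^+ 2 = b ^+ 2 by rewrite real_normK ?num_real.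
have hab : 0 <= `|a| * `|b| by rewrite mulr_ge0.
by nra.
Qed.

Lemma notin_closed N x : closed N -> ~ N x ->
  exists2 d : R, 0 < d & forall y, N y -> d <= nm (x - y).
Proof.
move=> cN Nx; apply: contrapT => h; apply: Nx; apply: (closedE N).1 => // e e0.
apply: contrapT => h'; apply: h; exists e => // y Ny.
by rewrite leNgt; apply/negP => xy; apply: h'; exists y.
Qed.

Lemma subspc_line N v : subspc N -> subspc [set x | exists a, N (x - a *: v)].
Proof.
move=> sN; split=> [|a x y [b Nb] [c Nc]]; first by exists 0; rewrite scale0r subr0; apply: subspc0.
exists (a * b + c); rewrite scalerDl opprD addrACA -scalerA -scalerBr.
by apply: subspcD => //; apply: subspcZ.
Qed.

(** If [v] is off [N], then [a] is controlled by the norm of [n + a v], so along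
    a convergent sequence of vectors [n + a v] the scalars [a] converge. *)
Lemma closed_line N v : closed N -> subspc N ->
  closed [set x | exists a, N (x - a *: v)].
Proof.
move=> cN sN.
have [Nv|Nv] := pselect (N v).
  suff -> : [set x | exists a, N (x - a *: v)] = N by [].
  apply/seteqP; split=> [x [a Na]|x Nx]; last by exists 0; rewrite scale0r subr0.
  by rewrite -[x](subrK (a *: v)); apply: subspcD => //; apply: subspcZ.
have [d d0 hd] := notin_closed cN Nv.
have dist n a : N n -> cn a * d <= nm (n + a *: v).
  move=> Nn; have [->|a0] := eqVneq a 0.
    by rewrite cn0 mul0r nm_ge0.
  have /hd : N (- (a^-1 *: n)) by apply: subspcN => //; apply: subspcZ.
  rewrite opprK => h.
  have -> : n + a *: v = a *: (v + a^-1 *: n).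
    by rewrite scalerDr scalerA divff // scale1r addrC.
  by rewrite nmZ ler_wpM2l // cn_ge0.
apply/closedE => x hx.
have /choice [y hy] n : exists y : X * R[i],
    N (y.1 - y.2 *: v) /\ nm (x - y.1) < half ^+ n.
  have [|y [a Na] xy] := hx (half ^+ n); first by rewrite exprn_gt0.
  by exists (y, a).
pose a n := (y n).2.
have step n : cn (a n.+1 - a n) <= 2 / d * half ^+ n.
  rewrite mulrAC ler_pdivlMr //.
  have [N1 h1] := hy n.+1; have [N0 h0] := hy n.
  apply: le_trans (dist _ _ (subspcB sN N1 N0)) _.
  have -> : (y n.+1).1 - (y n.+1).2 *: v - ((y n).1 - (y n).2 *: v) +
      (a n.+1 - a n) *: v = (y n.+1).1 - (y n).1.
    by rewrite /a scalerBl opprB [LHS]addrAC (addrA (_ - _)) subrK addrA subrK.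
  apply: le_trans (nm_tri x _ _) _.
  rewrite nmBC; apply: le_trans (lerD (ltW h1) (ltW h0)) _.
  have p0 : 0 <= half ^+ n :> R by rewrite exprn_ge0.
  have h2 : (2 : R) * half = 1 by rewrite divff.
  by rewrite exprS; nra.
have [l1 hl1] : exists l : R, forall n,
    `|l - complex.Re (a n)| <= 2 * (2 / d) * half ^+ n.
  apply: geo_complete_real => n; apply: le_trans (step n).
  by rewrite -raddfB; have [] := cn_ReIm (a n.+1 - a n).
have [l2 hl2] : exists l : R, forall n,
    `|l - complex.Im (a n)| <= 2 * (2 / d) * half ^+ n.
  apply: geo_complete_real => n; apply: le_trans (step n).
  by rewrite -raddfB; have [] := cn_ReIm (a n.+1 - a n).
exists (l1 +i* l2); apply: (closedE N).1 => // e e0.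
have [n hn] := half_small (1 + 2 * (2 * (2 / d)) * nm v) e0.
have [Nn xn] := hy n; exists ((y n).1 - (y n).2 *: v) => //.
apply: le_lt_trans hn.
have -> : x - (l1 +i* l2) *: v - ((y n).1 - (y n).2 *: v) =
    (x - (y n).1) - ((l1 +i* l2) - a n) *: v.
  by rewrite scalerBl /a !opprB addrACA [in RHS]addrACA; congr (_ + _); rewrite addrC.
apply: le_trans (nmB _ _) _; rewrite nmZ mulrDl mul1r lerD // ?(ltW xn) //.
rewrite mulrAC ler_wpM2r ?nm_ge0 //.
apply: le_trans (cn_le_ReIm _) _; rewrite !raddfB /=.
by have := hl1 n; have := hl2 n; lra.
Qed.

Definition add_span N m (w : nat -> X) : set X :=
  [set x | exists c : nat -> R[i], N (x - \sum_(i < m) c i *: w i)].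

Lemma add_spanS N m w : add_span N m.+1 w =
  [set x | exists a, add_span N m w (x - a *: w m)].
Proof.
apply/seteqP; split=> [x [c]|x [a [c Nc]]].
  rewrite big_ord_recr /= opprD addrA addrAC => Nc.
  by exists (c m), c.
exists (fun i => if i == m then a else c i).
rewrite big_ord_recr /= eqxx opprD addrA addrAC.
by under eq_bigr do rewrite (ltn_eqF (ltn_ord _)).
Qed.

Lemma add_span0 N w : add_span N 0 w = N.
Proof.
apply/seteqP; split=> [x [c]|x Nx]; first by rewrite big_ord0 subr0.
by exists (fun=> 0); rewrite big_ord0 subr0.
Qed.

Lemma subspc_add_span N m w : subspc N -> subspc (add_span N m w).
Proof.
move=> sN; elim: m => [|m IH]; first by rewrite add_span0.
by rewrite add_spanS; apply: subspc_line.
Qed.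

Lemma sub_add_span N m w : N `<=` add_span N m w.
Proof.
move=> x Nx; exists (fun=> 0); rewrite big1 ?subr0 // => i _; by rewrite scale0r.
Qed.

Lemma closed_add_span N m w : closed N -> subspc N -> closed (add_span N m w).
Proof.
move=> cN sN; elim: m => [|m IH]; first by rewrite add_span0.
by rewrite add_spanS; apply: closed_line => //; apply: subspc_add_span.
Qed.

Lemma closed_qdim N M : closed N -> subspc N -> subspc M -> N `<=` M ->
  qdim M N <> None -> closed M.
Proof.
move=> cN sN sM NM; case E: (qdim M N) => [m|] // _.
have [v [Mv _ sv]] := (qdim_Some _ _ sN).1 E.
suff -> : M = add_span N m v by apply: closed_add_span.
apply/seteqP; split=> [x Mx|x [c /NM Mc]]; first exact: sv.
rewrite -[x](subrK (\sum_(i < m) c i *: v i)); apply: subspcD => //.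
by apply: (subspc_sum c sM Mv).
Qed.

End ClosedSubspaces.

(** * Open mapping modulo a closed subspace *)

Section OpenMapping.
Context {R : realType} {X : completeNormedModType R[i]}.
Implicit Types (N M P Q G H B : set X) (A : {linear X -> X}).

(** [R(A) + N] *)
Definition range_add (A : X -> X) N : set X := [set y | exists x, N (y - A x)].

Lemma subspc_range_add A N : subspc N -> subspc (range_add A N).
Proof.
move=> sN; split=> [|a x y [u Nu] [v Nv]].
  by exists 0; rewrite linear0 subr0; apply: subspc0.
exists (a *: u + v); rewrite linearP opprD addrACA -scalerBr.
by apply: subspcD => //; apply: subspcZ.
Qed.

Lemma range_add_range A N x : subspc N -> range_add A N (A x).
Proof. by move=> sN; exists x; rewrite subrr; apply: subspc0. Qed.

Lemma range_add_sub A N : N `<=` range_add A N.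
Proof. by move=> x Nx; exists 0; rewrite linear0 subr0. Qed.

(** Successive approximation: each step halves the residual, and the
    corrections [x], taken in the closed set [Q], sum up. The residuals only
    need to stay in [G], which is neither a closed set nor a subspace here: the
    lemma serves for open mappings, for perturbations, and for proving that a
    range is closed. *)
Lemma iterate_lift A N Q G (C : R) : continuous A ->
  closed N -> subspc N -> closed Q -> subspc Q ->
  (forall w, G w -> exists x n, [/\ Q x, N n, nm x <= C * nm w,
     G (w - A x - n) & nm (w - A x - n) <= half * nm w]) ->
  forall w, G w -> exists x, [/\ Q x, nm x <= 2 * C * nm w & N (w - A x)].
Proof.
move=> /bounded_op[K K0 AK] cN sN cQ sQ step w Gw.
have /choice[f hf] v : exists p : X * X, G v -> [/\ Q p.1, N p.2,
    nm p.1 <= C * nm v, G (v - A p.1 - p.2) &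
    nm (v - A p.1 - p.2) <= half * nm v].
  have [/step[x [n h]]|nG] := pselect (G v); first by exists (x, n).
  by exists (0, 0).
pose nxt (p : X * X) := (p.1 + (f p.2).1, p.2 - A (f p.2).1 - (f p.2).2).
pose s n := (iter n nxt (0, w)).1; pose r n := (iter n nxt (0, w)).2.
have sS n : s n.+1 = s n + (f (r n)).1 by [].
have rS n : r n.+1 = r n - A (f (r n)).1 - (f (r n)).2 by [].
have rP n : [/\ G (r n), nm (r n) <= nm w * half ^+ n, Q (s n)
    & N (w - A (s n) - r n)].
  elim: n => [|n [Gr rn Qs Nn]].
    split=> //; first by rewrite expr0 mulr1.
      exact: subspc0.
    by rewrite /s /r /= linear0 subr0 subrr; apply: subspc0.
  have [Qf Nf fn Gf fh] := hf _ Gr; split=> //.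
  - by rewrite rS (le_trans fh) // exprS mulrCA ler_wpM2l.
  - by rewrite sS; apply: subspcD.
  - have -> : w - A (s n.+1) - r n.+1 = (w - A (s n) - r n) + (f (r n)).2.
      by rewrite rS sS linearD; zabel.
    exact: subspcD.
have C0 : 0 <= C * nm w.
  by have [_ _ fn _ _] := hf _ Gw; apply: le_trans fn; exact: nm_ge0.
have [C0'|C0'] := leP 0 C; last first.
  (* then [w = 0] *)
  have w0 : w = 0.
    by apply/eqP; rewrite -nm_eq0 eq_le nm_ge0 andbT -(nmulr_rge0 _ C0').
  exists 0; rewrite linear0 w0 subr0 nm0 mulr0; split=> //; exact: subspc0.
have [l hl] : exists l, forall n, nm (l - s n) <= 2 * (C * nm w) * half ^+ n.
  apply: geo_complete => n; rewrite sS addrAC subrr add0r.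
  have [Gr rn _ _] := rP n; have [_ _ fn _ _] := hf _ Gr.
  by rewrite (le_trans fn) // -mulrA ler_wpM2l.
exists l; split.
- apply: (closedE Q).1 => // e e0.
  have [n hn] := half_small (2 * (C * nm w)) e0.
  by exists (s n); [have [] := rP n|exact: le_lt_trans hn].
- by have := hl 0%N; rewrite /s /= subr0 expr0 mulr1 mulrA.
- apply: (closedE N).1 => // e e0.
  have [n hn] := half_small (K * (2 * (C * nm w)) + nm w) e0.
  have [_ rn _ Nn] := rP n; exists (w - A (s n) - r n) => //.
  apply: le_lt_trans hn.
  have -> : w - A l - (w - A (s n) - r n) = r n - A (l - s n).
    by rewrite (linearB A); zabel.
  apply: le_trans (nmB _ _) _; rewrite addrC mulrDl -mulrA lerD //.
  by apply: le_trans (AK _) _; rewrite ler_wpM2l ?(ltW K0).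
Qed.

(** Baire's theorem for the closed set [R(A) + N], covered by the sets
    [A(n-ball) + N], makes one of these dense in some ball; the density is then
    turned into exact lifts by successive approximation. *)
Lemma open_mapping A N : continuous A -> closed N -> subspc N ->
  closed (range_add A N) ->
  exists2 C : R, 0 < C & forall y, range_add A N y ->
    exists2 x, nm x <= C * nm y & N (y - A x).
Proof.
move=> cA cN sN cG; pose G := range_add A N.
have sG : subspc G by exact: subspc_range_add.
pose B (n : nat) y := exists2 x, nm x <= n%:R & N (y - A x).
have [n [y0 [e [e0 Gy0 dn]]]] : exists n y0 (e : R), [/\ 0 < e, G y0 &
    forall y, G y -> nm (y - y0) < e -> closure (B n) y].
  apply: contrapT => h.
  have /choice[f hf] (q : nat * (X * R)) : exists p : X * R,
      0 < q.2.2 -> G q.2.1 -> [/\ G p.1, 0 < p.2, nm (p.1 - q.2.1) <= q.2.2 / 4,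
        p.2 <= q.2.2 / 2 & forall z, B q.1 z -> p.2 < nm (p.1 - z)].
    case: q => n [y0 e] /=.
    have [e0|] := ltP 0 e; last by exists (0, 0).
    have [Gy0|] := pselect (G y0); last by exists (0, 0).
    have [y [Gy ye ny]] : exists y, [/\ G y, nm (y - y0) < e / 4 & ~ closure (B n) y].
      apply: contrapT => h'; apply: h; exists n, y0, (e / 4); split=> //.
        by rewrite divr_gt0.
      by move=> y Gy ye; apply: contrapT => ny; apply: h'; exists y.
    have [d d0 hd] : exists2 d : R, 0 < d & forall z, B n z -> d <= nm (y - z).
      apply: contrapT => h'; apply: ny; apply/closureE => d d0.
      apply: contrapT => h2; apply: h'; exists d => // z Bz.
      by rewrite leNgt; apply/negP => yz; apply: h2; exists z.
    exists (y, Num.min (e / 2) (d / 2)) => _ _ /=; split=> //.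
    - by rewrite lt_min !divr_gt0.
    - exact: ltW.
    - by rewrite ge_min lexx.
    - move=> z /hd; apply: lt_le_trans.
      by rewrite gt_min; apply/orP; right; lra.
  pose p := fix p k : X * R := if k is k'.+1 then f (k', p k') else (0, 1).
  have pP k : 0 < (p k).2 /\ G (p k).1.
    elim: k => [|k [IH1 IH2]] /=; first by split=> //; exact: subspc0.
    by have [] := hf (k, p k) IH1 IH2.
  have pS k : [/\ nm ((p k.+1).1 - (p k).1) <= (p k).2 / 4,
      (p k.+1).2 <= (p k).2 / 2 &
      forall z, B k z -> (p k.+1).2 < nm ((p k.+1).1 - z)].
    by have [p1 p2] := pP k; have [] := hf (k, p k) p1 p2.
  have nest k j : nm ((p (k + j)%N).1 - (p k).1) + (p (k + j)%N).2 / 2 <= (p k).2 / 2.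
    elim: j => [|j IH]; first by rewrite addn0 subrr nm0 add0r.
    rewrite addnS; have [h1 h2 _] := pS (k + j)%N.
    have := nm_tri (p (k + j)%N).1 (p (k + j).+1).1 (p k).1.
    by lra.
  have pe k : (p k).2 <= half ^+ k.
    elim: k => [|k IH]; first by rewrite expr0.
    by have [_ h2 _] := pS k; rewrite exprS; lra.
  have [l hl] : exists l, forall k, nm (l - (p k).1) <= 2 * 1 * half ^+ k.
    apply: geo_complete => k; have [h1 _ _] := pS k.
    by have := pe k; have [] := pP k; rewrite mul1r; lra.
  have lp k : nm (l - (p k).1) <= (p k).2 / 2.
    apply/ler_addgt0Pr => d d0; have [j hj] := half_small (2 * 1) d0.
    have := nm_tri (p (k + j)%N).1 l (p k).1; have := nest k j.
    have := hl (k + j)%N; have [] := pP (k + j)%N.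
    have : 2 * 1 * half ^+ (k + j) <= 2 * 1 * half ^+ j :> R.
      rewrite ler_wpM2l // ?mulr_ge0 // exprD ler_piMl ?exprn_ge0 //.
      by rewrite exprn_ile1 // ?invr_ge0 // invf_le1 // ler1n.
    by lra.
  have Gl : G l.
    apply: (closedE G).1 => // d d0; have [j hj] := half_small (2 * 1) d0.
    by exists (p j).1; [have [] := pP j|exact: le_lt_trans hj].
  have [x Nx] := Gl.
  have : B (Num.bound (nm x)) l.
    by exists x => //; apply/ltW/archi_boundP; exact: nm_ge0.
  move: (Num.bound (nm x)) => k Bl.
  have [_ _ /(_ l Bl)] := pS k; have := lp k.+1; rewrite nmBC.
  by have [] := pP k.+1; lra.
pose C := 4 * n%:R / e + 1.
have C0 : 0 < C by rewrite ltr_wpDl // divr_ge0 ?(ltW e0) // mulr_ge0.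
exists (2 * C); first by rewrite mulr_gt0.
have sT : subspc [set: X] by [].
suff step w : G w -> exists x n0, [/\ [set: X] x, N n0, nm x <= C * nm w,
    G (w - A x - n0) & nm (w - A x - n0) <= half * nm w].
  move=> y Gy.
  have [x [_ xC Nx]] := iterate_lift cA cN sN closedT sT step Gy.
  by exists x.
move=> Gw; have [->|w0] := eqVneq w 0.
  exists 0, 0; rewrite linear0 !subr0 nm0 !mulr0; split=> //; exact: subspc0.
have nw : 0 < nm w by rewrite nm_gt0.
pose t := e / (2 * nm w).
have t0 : 0 < t by rewrite divr_gt0 // mulr_gt0.
have tw : nm (t%:C *: w) = e / 2.
  by rewrite nmZ cn_real gtr0_norm // /t invfM mulrA divfK ?gt_eqF.
have e8 : 0 < e / 8 by rewrite divr_gt0.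
have /closureE/(_ _ e8)[z1 [x1 x1n N1] z1e] : closure (B n) (y0 + t%:C *: w).
  apply: dn; first by apply: subspcD => //; apply: subspcZ.
  by rewrite addrAC subrr add0r tw; lra.
have /closureE/(_ _ e8)[z2 [x2 x2n N2] z2e] : closure (B n) y0.
  by apply: dn => //; rewrite subrr nm0.
pose x := t^-1%:C *: (x1 - x2).
pose n0 := t^-1%:C *: ((z1 - A x1) - (z2 - A x2)).
have Nn0 : N n0 by apply: subspcZ => //; apply: subspcB.
have tV : t^-1%:C * t%:C = 1 :> R[i] by rewrite -rmorphM /= mulVf ?gt_eqF.
have eqw : w - A x - n0 = t^-1%:C *: ((y0 + t%:C *: w - z1) - (y0 - z2)).
  rewrite /x /n0 linearZ linearB -{1}[w]scale1r -tV -scalerA -!scalerBr.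
  by congr (_ *: _); zabel.
have nmt u : nm (t^-1%:C *: u) = 2 * nm w / e * nm u.
  by rewrite nmZ cn_real gtr0_norm ?invr_gt0 // /t invf_div.
exists x, n0; split=> //.
- rewrite /x nmt; have := nmB x1 x2.
  have a0 : 0 <= 2 * nm w / e by rewrite divr_ge0 ?(ltW e0) // mulr_ge0 // ltW.
  move=> h; have : nm (x1 - x2) <= 2 * n%:R by lra.
  move=> {}h; apply: le_trans (ler_wpM2l a0 h) _.
  rewrite /C [leRHS]mulrDl mul1r.
  have -> : 2 * nm w / e * (2 * n%:R) = 4 * n%:R / e * nm w by field; rewrite gt_eqF.
  by rewrite lerDl ltW.
- apply: subspcB => //; last exact: range_add_sub.
  by apply: subspcB => //; exact: range_add_range.
- rewrite eqw nmt; have := nmB (y0 + t%:C *: w - z1) (y0 - z2).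
  have a0 : 0 <= 2 * nm w / e by rewrite divr_ge0 ?(ltW e0) // mulr_ge0 // ltW.
  move=> h; have {}h : nm (y0 + t%:C *: w - z1 - (y0 - z2)) <= e / 4 by lra.
  apply: le_trans (ler_wpM2l a0 h) _.
  have -> : 2 * nm w / e * (e / 4) = half * nm w by field; rewrite gt_eqF.
  exact: lexx.
Qed.

End OpenMapping.

Section Neubauer.
Context {R : realType} {X : completeNormedModType R[i]}.
Implicit Types (N M P Q G H B : set X) (A : {linear X -> X}).

(** Neubauer's lemma. A point [y] of the closure of [B] is approximated by
    [b] in [B]; lifting the small vector [y - b] through [R(A) + H] and moving
    its [A]-part into [B] leaves a small error in [H]. Differences of two such
    errors lie in the closed set [B] meet [H], hence so does each error. *)
Lemma neubauer A H B : continuous A -> closed H -> subspc H -> subspc B ->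
  closed (range_add A H) -> (forall x, B (A x)) -> B `<=` range_add A H ->
  closed (B `&` H) -> closed B.
Proof.
move=> cA cH sH sB cG BA BG cBH.
have [C C0 hC] := open_mapping cA cH sH cG.
have [K K0 AK] := bounded_op cA.
apply/closedE => y hy.
have Gy : range_add A H y.
  by apply: (closedE _).1 => // e /hy[b /BG Gb yb]; exists b.
have sG := subspc_range_add A sH.
have approx e : 0 < e -> exists b, [/\ B b, H (y - b) & nm (y - b) < e].
  move=> e0; pose e' := e / (1 + K * C).
  have KC : 0 < 1 + K * C by rewrite ltr_pwDl // ltW // mulr_gt0.
  have [|b Bb yb] := hy e'; first by rewrite divr_gt0.
  have [x xC Hx] := hC _ (subspcB sG Gy (BG _ Bb)).
  have eq1 : y - (b + A x) = y - b - A x by zabel.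
  exists (b + A x); rewrite eq1; split=> //; first exact: subspcD.
  apply: le_lt_trans (nmB _ _) _.
  have : nm (A x) <= K * (C * nm (y - b)).
    by apply: le_trans (AK _) _; rewrite ler_wpM2l // ltW.
  have : (1 + K * C) * nm (y - b) < e by rewrite mulrC -ltr_pdivlMr.
  lra.
have [b0 [Bb0 Hb0 _]] := approx 1 ltr01.
suff : (B `&` H) (y - b0) by move=> [By _]; rewrite -[y](subrK b0); apply: subspcD.
apply: (closedE _).1 => // e /approx[b [Bb Hb yb]].
exists (b - b0); last by have -> : y - b0 - (b - b0) = y - b by zabel.
split; first exact: subspcB.
have -> : b - b0 = (y - b0) - (y - b) by zabel.
exact: subspcB.
Qed.

Lemma dimge_not_add_span N P m (w : nat -> X) : subspc N ->
  dimge P N m.+1 -> exists2 v, P v & ~ add_span N m w v.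
Proof.
move=> sN [u Pu iu]; apply: contrapT => h.
suff : (m.+1 <= m)%N by rewrite ltnn.
apply: (steinitz (w := w) sN iu) => i im.
by apply: contrapT => hu; apply: h; exists (u i); [exact: Pu|].
Qed.

(** F. Riesz's lemma, iterated. The bound [4 ^ m] on the coordinates depends on
    [m] only, neither on [P] nor on [N]. *)
Lemma riesz_basis N P m : closed N -> subspc N -> subspc P -> N `<=` P ->
  dimge P N m ->
  exists w : nat -> X, (forall i, (i < m)%N -> P (w i) /\ nm (w i) <= 1) /\
    forall (c : nat -> R[i]) n, N n -> forall i, (i < m)%N ->
      cn (c i) <= 4 ^+ m * nm (\sum_(j < m) c j *: w j + n).
Proof.
move=> cN sN sP NP; elim: m => [|m IH] dm; first by exists (fun=> 0); split.
have [w [Pw bw]] := IH (dimge_leq (leqnSn m) dm).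
have [v Pv Nv] := dimge_not_add_span w sN dm.
pose N' := add_span N m w.
have cN' : closed N' by exact: closed_add_span.
have sN' : subspc N' by exact: subspc_add_span.
have N'P : N' `<=` P.
  move=> x [c /NP Pc]; rewrite -[x](subrK (\sum_(i < m) c i *: w i)).
  apply: subspcD => //; apply: (subspc_sum c sP) => i im.
  by have [] := Pw i im.
have [d0 d0_gt0 hd0] := notin_closed cN' Nv.
pose S := [set nm (v - y) | y in N'].
have lS : lbound S d0 by move=> _ [y N'y <-]; exact: hd0.
have iS : has_inf S.
  by split; [exists (nm (v - 0)), 0 => //; exact: subspc0|exists d0].
have d0S : d0 <= inf S by apply: lb_le_inf => //; case: iS.
have infS : 0 < inf S by exact: lt_le_trans d0S.
have [_ [y N'y <-] ye] := inf_adherent infS iS.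
have hS z : N' z -> inf S <= nm (v - z).
  by move=> N'z; apply: ge_inf; [case: iS|exists z].
pose r := nm (v - y); have r0 : 0 < r := lt_le_trans infS (hS _ N'y).
pose u := r^-1%:C *: (v - y).
have nu : nm u = 1.
  by rewrite nmZ cn_real gtr0_norm ?invr_gt0 // mulVf // gt_eqF.
have dist a z : N' z -> cn a <= 2 * nm (a *: u + z).
  move=> N'z; have [->|a0] := eqVneq a 0; first by rewrite cn0 mulr_ge0 ?nm_ge0.
  pose z' := y - r%:C *: (a^-1 *: z).
  have N'z' : N' z' by apply: subspcB => //; apply: subspcZ => //; apply: subspcZ.
  have -> : a *: u + z = (a * r^-1%:C) *: (v - z').
    have r1 : r^-1%:C * r%:C = 1 :> R[i] by rewrite -rmorphM /= mulVf // gt_eqF.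
    have -> : v - z' = (v - y) + r%:C *: (a^-1 *: z) by rewrite /z'; zabel.
    rewrite [RHS]scalerDr !scalerA; congr (_ + _).
    by rewrite -[z in LHS]scale1r; congr (_ *: _); rewrite -!mulrA [r^-1%:C * _]mulrA r1 mul1r divff.
  rewrite nmZ cnM cn_real gtr0_norm ?invr_gt0 //.
  have := hS _ N'z'; rewrite -/r in ye => h.
  have h2 : r <= 2 * nm (v - z') by lra.
  rewrite -mulrA mulrCA; apply: (le_trans (y := cn a * 1)); first by rewrite mulr1.
  rewrite ler_wpM2l ?cn_ge0 // mulrCA -ler_pdivrMl ?invr_gt0 //.
  by rewrite invrK mulr1.
pose w' i := if (i < m)%N then w i else u.
have w'E (c : nat -> R[i]) :
    \sum_(i < m.+1) c i *: w' i = \sum_(i < m) c i *: w i + c m *: u.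
  rewrite big_ord_recr /= /w' ltnn; congr (_ + _).
  by apply: eq_bigr => i _; rewrite ltn_ord.
exists w'; split=> [i _|c n Nn i im].
  rewrite /w'; case: ifPn => [/Pw//|_]; rewrite nu; split=> //.
  by apply: subspcZ => //; apply: subspcB => //; exact: N'P.
rewrite w'E; set s := \sum_(j < m) _.
have cm : cn (c m) <= 2 * nm (s + c m *: u + n).
  have -> : s + c m *: u + n = c m *: u + (s + n) by zabel.
  apply: dist; exists c.
  by have -> : s + n - s = n by zabel.
have p4 : 1 <= 4 ^+ m :> R by rewrite exprn_ege1 // ler1n.
have t0 := nm_ge0 (s + c m *: u + n).
rewrite exprS; move: im; rewrite ltnS leq_eqVlt => /orP[/eqP ->|im].
  apply: le_trans cm _; rewrite ler_wpM2r //.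
  lra.
apply: le_trans (bw c n Nn i im) _.
have : nm (s + n) <= 3 * nm (s + c m *: u + n).
  have -> : s + n = (s + c m *: u + n) - c m *: u by zabel.
  apply: le_trans (nmB _ _) _; rewrite nmZ nu mulr1.
  lra.
move=> h; rewrite [4 * _]mulrC -mulrA ler_wpM2l ?exprn_ge0 //.
lra.
Qed.

End Neubauer.

Definition shiftop (K : comNzRingType) (V : lmodType K) (T : V -> V) (a : K) :=
  fun x => T x - a *: x.

Section ShiftLinear.
Context (K : comNzRingType) (V : lmodType K) (T : {linear V -> V}) (a : K).

Lemma shift_is_linear : linear (shiftop T a).
Proof.
move=> b x y; rewrite /shiftop linearP scalerDr scalerBr !scalerA mulrC.
by zabel.
Qed.

HB.instance Definition _ := GRing.isLinear.Build K V V _ (shiftop T a)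
  shift_is_linear.

Lemma shiftD x y : shiftop T a (x + y) = shiftop T a x + shiftop T a y.
Proof. exact: linearD. Qed.

Lemma shiftB x y : shiftop T a (x - y) = shiftop T a x - shiftop T a y.
Proof. exact: linearB. Qed.

Lemma shiftZ b x : shiftop T a (b *: x) = b *: shiftop T a x.
Proof. exact: linearZ. Qed.

End ShiftLinear.

Lemma shift_continuous (R : realType) (X : normedModType R[i])
  (T : {linear X -> X}) (a : R[i]) : continuous T -> continuous (shiftop T a).
Proof.
move=> cT x; apply: (@continuousB _ _ _ T) => //; first exact: cT.
exact: scaler_continuous.
Qed.

(** * Stability of semi-regular operators *)

(** Walking along the segment from [0] to [a]. The step [rho] may depend on
    [P]: below, [P] is about dimensions at least [m], and [rho] depends on [m]. *)
Lemma small_steps (R : realType) (P : R[i] -> Prop) (r rho : R) : 0 < rho ->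
  (forall a b, cn a <= r -> cn b <= r -> cn (a - b) <= rho -> P b -> P a) ->
  forall a, cn a <= r -> P 0 <-> P a.
Proof.
move=> rho0 step a ar; pose K := Num.bound (cn a / rho).
have K0 : 0 < K%:R :> R.
  apply: le_lt_trans (archi_boundP _); rewrite divr_ge0 ?cn_ge0 ?ltW //.
have aK : cn a / K%:R <= rho.
  rewrite ler_pdivrMr // mulrC -ler_pdivrMr // ltW // archi_boundP //.
  by rewrite divr_ge0 ?cn_ge0 ?ltW.
pose p k : R[i] := (k%:R / K%:R)%:C * a.
have p0 : p 0%N = 0 by rewrite /p mul0r mul0r.
have pK : p K = a by rewrite /p divff ?gt_eqF // mul1r.
have pr k : (k <= K)%N -> cn (p k) <= r.
  move=> kK; apply: le_trans ar; rewrite /p cnM cn_real ger0_norm ?divr_ge0 //.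
  by rewrite ler_piMl ?cn_ge0 // ler_pdivrMr // mul1r ler_nat.
have pS k : cn (p k.+1 - p k) <= rho.
  rewrite /p -mulrBl -rmorphB /= -mulrBl -natrB // subSnn.
  by rewrite cnM cn_real ger0_norm ?divr_ge0 // mul1r mulrC.
have all k : (k <= K)%N -> P 0 <-> P (p k).
  elim: k => [|k IH] kK; first by rewrite p0.
  rewrite IH ?(ltnW kK) //; split; apply: step => //; try exact: pr.
  - exact: pr (ltnW kK).
  - exact: pr (ltnW kK).
  - by rewrite -cnN opprB.
by have := all K (leqnn K); rewrite pK.
Qed.

Section Stability.
Context {R : realType} {X : completeNormedModType R[i]}.

Lemma nm_sum m (c : nat -> R[i]) (v : nat -> X) (eta : R) :
  (forall i, (i < m)%N -> nm (v i) <= eta) ->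
  nm (\sum_(i < m) c i *: v i) <= eta * \sum_(i < m) cn (c i).
Proof.
elim: m => [|m IH] h; first by rewrite !big_ord0 nm0 mulr0.
rewrite !big_ord_recr /= mulrDr; apply: le_trans (nmD _ _) _.
rewrite nmZ lerD //; first by apply: IH => i im; apply: h; exact: ltnW.
by rewrite mulrC ler_wpM2r ?cn_ge0 // h.
Qed.

Lemma sum_cn_le m (c : nat -> R[i]) (k : R) :
  (forall i, (i < m)%N -> cn (c i) <= k) -> \sum_(i < m) cn (c i) <= m%:R * k.
Proof.
move=> h; elim: m h => [|m IH] h; first by rewrite big_ord0 mul0r.
rewrite big_ord_recr /= -addn1 natrD mulrDl mul1r lerD ?h //.
by apply: IH => i im; apply: h; exact: ltnW.
Qed.

Lemma sum_cn_eq0 m (c : nat -> R[i]) : \sum_(i < m) cn (c i) <= 0 ->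
  forall i, (i < m)%N -> c i = 0.
Proof.
move=> S0 i im; apply/eqP; rewrite -cn_eq0 eq_le cn_ge0 andbT.
apply: le_trans S0; rewrite (bigD1 (Ordinal im)) //= lerDl.
by apply: sumr_ge0 => j _; exact: cn_ge0.
Qed.

(* [N] and [Z / N] play the roles of [{0}] and of the hyperrange of a semi-regular
   operator on [X / N]; [C] bounds the lifts through it. *)
Context (T : {linear X -> X}) (cT : continuous T) (N Z : set X).
Hypotheses (cN : closed N) (sN : subspc N) (cZ : closed Z) (sZ : subspc Z).
Hypotheses (NZ : N `<=` Z) (TN : forall x, N x -> N (T x))
  (TZ : forall x, Z (T x) <-> Z x) (ZR : Z `<=` range_add T N).
Variable C : R.
Hypothesis C0 : 0 < C.
Hypothesis liftC : forall w, range_add T N w ->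
  exists2 x, nm x <= C * nm w & N (w - T x).
Implicit Types (a b : R[i]).

(** The lift [x] of [w] through [T] lies in [Z], and leaves the residual [a x],
    of norm at most half that of [w]. *)
Lemma shift_lift a : C * cn a <= half -> forall w, Z w ->
  exists x, [/\ Z x, nm x <= 2 * C * nm w & N (w - shiftop T a x)].
Proof.
move=> Ca; apply: iterate_lift => // [|w Zw]; first exact: shift_continuous.
have [x xC Nx] := liftC (ZR Zw).
have Zx : Z x.
  apply/TZ; have -> : T x = w - (w - T x) by zabel.
  by apply: subspcB => //; exact: NZ.
exists x, (w - T x).
have -> : w - shiftop T a x - (w - T x) = a *: x by rewrite /shiftop; zabel.
split=> //; first exact: subspcZ.
rewrite nmZ; apply: le_trans (ler_wpM2l (cn_ge0 a) xC) _.
by rewrite mulrCA mulrA ler_wpM2r // nm_ge0.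
Qed.

(** On [X / Z], [T] is injective and its inverse is bounded by [C]; hence [T - a]
    is injective, with an inverse bounded by [2 * C]. The error [e] is there
    because distances to [Z] need not be attained. *)
Lemma shift_dist a : C * cn a <= half -> forall x w, Z (w - shiftop T a x) ->
  forall e : R, 0 < e -> exists2 z, Z z & nm (x - z) <= 2 * C * nm w + e.
Proof.
move=> Ca x w Zw e e0; have [k hk] := half_small (nm x) e0.
suff [z Zz zk] : exists2 z, Z z &
    nm (x - z) <= 2 * C * nm w + nm x * half ^+ k.
  by exists z => //; apply: le_trans zk _; rewrite lerD2l ltW.
elim: {hk} k => [|k [z Zz zk]].
  exists 0; first exact: subspc0.
  by rewrite subr0 expr0 mulr1 lerDr !mulr_ge0 ?nm_ge0 // ltW.
have sG := subspc_range_add T sN.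
pose v := w + a *: (x - z).
have vE : v = T x + (w - shiftop T a x) - a *: z.
  by rewrite /v /shiftop scalerBr; zabel.
have Gv : range_add T N v.
  rewrite vE; apply: subspcB => //; last by apply: subspcZ => //; exact: ZR.
  by apply: subspcD => //; [exact: range_add_range|exact: ZR].
have [y yC Ny] := liftC Gv.
exists (x - y).
  apply/TZ; rewrite (linearB T).
  have -> : T x - T y = (v - T y) - (w - shiftop T a x) + a *: z.
    by rewrite vE; zabel.
  apply: subspcD => //; last exact: subspcZ.
  by apply: subspcB => //; exact: NZ.
have -> : x - (x - y) = y by zabel.
apply: le_trans yC _.
have : nm v <= nm w + cn a * nm (x - z).
  by rewrite /v -nmZ nmD.
move=> /(ler_wpM2l (ltW C0)) h; apply: le_trans h _.
have xz := nm_ge0 (x - z).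
have : C * (cn a * nm (x - z)) <= half * nm (x - z).
  by rewrite mulrA ler_wpM2r.
rewrite exprS; lra.
Qed.

Lemma shift_ker_sub a : C * cn a <= half ->
  [set x | N (shiftop T a x)] `<=` Z.
Proof.
move=> Ca x Nx; apply: (closedE Z).1 => // e e0.
have Zx : Z (0 - shiftop T a x) by rewrite sub0r; apply: subspcN => //; exact: NZ.
have e2 : 0 < e / 2 by rewrite divr_gt0.
have [z Zz zx] := shift_dist Ca Zx e2.
by exists z => //; apply: le_lt_trans zx _; rewrite nm0 mulr0; lra.
Qed.

Lemma shift_stable a x : Z x -> Z (shiftop T a x).
Proof. by move=> Zx; apply: subspcB => //; [exact/TZ|exact: subspcZ]. Qed.

Lemma shift_range_addZ a : C * cn a <= half ->
  range_add (shiftop T a) N = range_add (shiftop T a) Z.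
Proof.
move=> Ca; apply/seteqP; split=> [y [x Nx]|y [x /(shift_lift Ca)[z [Zz _ Nz]]]].
  by exists x; exact: NZ.
exists (x + z); suff -> : y - shiftop T a (x + z) = y - shiftop T a x - shiftop T a z by [].
by rewrite shiftD; zabel.
Qed.

(** Since [Z] is in [R(T - a) + N], one may work modulo [Z], where [T - a] is
    bounded below. *)
Lemma shift_closed a : C * cn a <= half -> closed (range_add (shiftop T a) N).
Proof.
move=> Ca; rewrite shift_range_addZ //.
have cA := shift_continuous (a := a) cT.
set G := range_add _ _; have sG : subspc G by exact: subspc_range_add.
apply/closedE => y hy.
pose G' := [set y | forall e, 0 < e -> exists2 g, G g & nm (y - g) < e].
suff step w : G' w -> exists x n, [/\ [set: X] x, Z n, nm x <= 4 * C * nm w,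
    G' (w - shiftop T a x - n) & nm (w - shiftop T a x - n) <= half * nm w].
  have sT : subspc [set: X] by [].
  by have [x [_ _ Zx]] := iterate_lift cA cZ sZ closedT sT step hy; exists x.
move=> Gw; have [->|w0] := eqVneq w 0.
  exists 0, 0; rewrite linear0 !subr0 nm0 !mulr0; split=> //; first exact: subspc0.
  by move=> e e0; exists 0; rewrite ?subrr ?nm0 //; exact: subspc0.
have nw : 0 < nm w by rewrite nm_gt0.
have h2 : 0 < half * nm w by rewrite mulr_gt0.
have [w' [x Zx] ww'] := Gw _ h2.
have Cw : 0 < C * nm w by rewrite mulr_gt0.
have [z Zz xz] := shift_dist Ca Zx Cw.
have eqn : w - shiftop T a (x - z) - (w' - shiftop T a (x - z)) = w - w' by zabel.
exists (x - z), (w' - shiftop T a (x - z)); rewrite eqn; split=> //.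
- have -> : w' - shiftop T a (x - z) = w' - shiftop T a x + shiftop T a z.
    by rewrite shiftB; zabel.
  by apply: subspcD => //; exact: shift_stable.
- apply: le_trans xz _.
  have : nm w' <= nm w + half * nm w.
    have -> : w' = w - (w - w') by zabel.
    by apply: le_trans (nmB _ _) _; rewrite lerD2l ltW.
  move=> /(ler_wpM2l (ltW C0)) h; rewrite -mulrA -mulrA.
  rewrite mulrDr mulrCA in h; lra.
- move=> e /Gw[g Gg wg]; exists (g - w').
    by apply: subspcB => //; exists x.
  by have -> : w - w' - (g - w') = w - g by zabel.
- exact: ltW.
Qed.

(* Chosen for [rhoP], which makes both perturbation sums below at most 3/4 of
   the quantity that they bound. *)
Let rho m : R := half / (2 * C * (m%:R * 4 ^+ m) + 1).

Let den_gt0 m : 0 < 2 * C * (m%:R * 4 ^+ m) + 1.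
Proof. by rewrite ltr_wpDl // !mulr_ge0 ?exprn_ge0 // ltW. Qed.

Let rho_gt0 m : 0 < rho m.
Proof. by rewrite divr_gt0. Qed.

Let rhoP m (d : R) : 0 <= d -> d <= rho m -> m%:R * 4 ^+ m * (2 * C * d) <= half.
Proof. by move=> d0; rewrite ler_pdivlMr // => h; lra. Qed.

(** Modulo [N]: a vector [w] of the kernel of [T - b] lies in [Z], so the small
    vector [(b - a) w] has a small lift [v] through [T - a], and [w - v] is in the
    kernel of [T - a]. Small perturbations of a Riesz basis are independent. *)
Lemma shift_ker_dim_step m a b : C * cn a <= half -> C * cn b <= half ->
  cn (a - b) <= rho m ->
  dimge [set x | N (shiftop T b x)] N m -> dimge [set x | N (shiftop T a x)] N m.
Proof.
move=> Ca Cb ab db; pose d := cn (a - b).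
have sK : subspc [set x | N (shiftop T b x)].
  split=> [|c x y Nx Ny]; first by rewrite /= linear0; exact: subspc0.
  by rewrite /= linearP; apply: subspcD => //; exact: subspcZ.
have NK : N `<=` [set x | N (shiftop T b x)].
  by move=> x Nx; apply: subspcB => //; [exact: TN|exact: subspcZ].
have [w [Kw bw]] := riesz_basis cN sN sK NK db.
have /choice[v hv] i : exists v, (i < m)%N -> nm v <= 2 * C * d /\
    N ((b - a) *: w i - shiftop T a v).
  have [im|] := boolP (i < m)%N; last by exists 0.
  have [Ki wi] := Kw i im.
  have Zw : Z ((b - a) *: w i) by apply: subspcZ => //; exact: (shift_ker_sub Cb).
  have [v [_ vC Nv]] := shift_lift Ca Zw; exists v => _; split=> //.
  apply: le_trans vC _; rewrite nmZ -cnN opprB -/d.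
  by rewrite ler_wpM2l ?mulr_ge0 ?(ltW C0) // ler_piMr ?cn_ge0.
exists (fun i => w i - v i).
  move=> i im; have [Ki _] := Kw i im; have [_ Ni] := hv i im.
  rewrite /=; have -> : shiftop T a (w i - v i) =
      shiftop T b (w i) + ((b - a) *: w i - shiftop T a (v i)).
    by rewrite shiftB /shiftop scalerBl; zabel.
  exact: subspcD.
move=> c Nc; pose S := \sum_(i < m) cn (c i).
apply: sum_cn_eq0; rewrite -/S.
have d0 : 0 <= d by exact: cn_ge0.
have S0 : 0 <= S by apply: sumr_ge0 => i _; exact: cn_ge0.
have hc i : (i < m)%N -> cn (c i) <= 4 ^+ m * (2 * C * d * S).
  move=> im; apply: le_trans (bw c _ (subspcN sN Nc) i im) _.
  rewrite ler_wpM2l ?exprn_ge0 //.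
  under [X in _ - X]eq_bigr do rewrite scalerBr.
  rewrite sumrB opprB addrC subrK.
  by apply: nm_sum => j jm; have [] := hv j jm.
have := sum_cn_le hc; rewrite -/S.
have := ler_wpM2r S0 (rhoP d0 ab).
by lra.
Qed.

(** Let [G = R(T - b) + N]. If a combination [y] of a Riesz basis modulo [G] were
    [(T - a) x] modulo [N], then modulo [G], which contains [Z], it would be
    [(b - a) (x - z)] for each [z] in [Z], and [x - z] is bounded by [y] for
    some [z]. *)
Lemma shift_coker_dim_step m a b : C * cn a <= half -> C * cn b <= half ->
  cn (a - b) <= rho m ->
  dimge [set: X] (range_add (shiftop T b) N) m ->
  dimge [set: X] (range_add (shiftop T a) N) m.
Proof.
move=> Ca Cb ab db; pose d := cn (a - b).
have sT : subspc [set: X] by [].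
have sG : subspc (range_add (shiftop T b) N) by exact: subspc_range_add.
have [w [Kw bw]] := riesz_basis (shift_closed Cb) sG sT (@subsetT _ _) db.
exists w => // c [x Nx]; pose S := \sum_(i < m) cn (c i).
apply: sum_cn_eq0; rewrite -/S leNgt; apply/negP => S0.
have d0 : 0 <= d by exact: cn_ge0.
set y := \sum_(i < m) _ in Nx.
have yS : nm y <= S.
  rewrite -[leRHS]mul1r; apply: nm_sum => i im; by have [] := Kw i im.
have CS : 0 < C * S by rewrite mulr_gt0.
have [z Zz xz] := shift_dist Ca (NZ Nx) CS.
have hx : nm (x - z) <= 3 * C * S.
  by have := ler_wpM2l (ltW C0) yS; lra.
have Gg : range_add (shiftop T b) N ((a - b) *: z - (y - shiftop T a x) - shiftop T b x).
  apply: subspcB => //; last exact: range_add_range.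
  apply: subspcB => //; last exact: range_add_sub.
  by apply: subspcZ => //; rewrite shift_range_addZ //; exact: range_add_sub.
have hc i : (i < m)%N -> cn (c i) <= 4 ^+ m * (d * (3 * C * S)).
  move=> im; apply: le_trans (bw c _ Gg i im) _; rewrite -/y.
  rewrite ler_wpM2l ?exprn_ge0 //.
  have -> : y + ((a - b) *: z - (y - shiftop T a x) - shiftop T b x) =
      (b - a) *: (x - z).
    by rewrite /shiftop !scalerBl !scalerBr; zabel.
  by rewrite nmZ -cnN opprB ler_wpM2l ?cn_ge0.
have := sum_cn_le hc; rewrite -/S.
have := ler_wpM2r (ltW S0) (rhoP d0 ab).
by lra.
Qed.

Let C_cn a : cn a <= half / C -> C * cn a <= half.
Proof. by rewrite ler_pdivlMr // mulrC. Qed.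

Lemma shift_ker_dim a : cn a <= half / C ->
  qdim [set x | N (T x)] N = qdim [set x | N (shiftop T a x)] N.
Proof.
move=> Ca.
have -> : [set x | N (T x)] = [set x | N (shiftop T 0 x)].
  by apply/seteqP; split=> x; rewrite /= /shiftop scale0r subr0.
apply: qdim_ext => // m.
apply: (small_steps (P := fun a => dimge [set x | N (shiftop T a x)] N m)
  (rho_gt0 m)) Ca => b b' /C_cn h /C_cn h'.
exact: shift_ker_dim_step.
Qed.

Lemma shift_coker_dim a : cn a <= half / C ->
  qdim [set: X] (range_add T N) = qdim [set: X] (range_add (shiftop T a) N).
Proof.
move=> Ca.
have -> : range_add T N = range_add (shiftop T 0) N.
  have E : shiftop T 0 = T :> (X -> X).
    by apply/funext => x; rewrite /shiftop scale0r subr0.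
  by rewrite E.
apply: qdim_ext; try exact: subspc_range_add.
move=> m; apply: (small_steps
  (P := fun a => dimge [set: X] (range_add (shiftop T a) N) m) (rho_gt0 m)) Ca.
by move=> b b' /C_cn h /C_cn h'; exact: shift_coker_dim_step.
Qed.

End Stability.

(** * Kernels and ranges of the powers of an operator *)

Lemma nat_inf_Some (P : set nat) n :
  nat_inf P = Some n -> P n /\ forall m, P m -> (n <= m)%N.
Proof.
rewrite /nat_inf; case: pselect => // exP [<-].
by case: ex_minnP => k /asboolP Pk kmin; split=> // m Pm; apply/kmin/asboolP.
Qed.

Lemma nat_inf_finite (P : set nat) : nat_inf P <> None <-> exists n, P n.
Proof.
rewrite /nat_inf; case: pselect => [exP|nP].
  by split=> // _; have [n /asboolP Pn] := exP; exists n.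
by split=> [//|[n Pn]]; exfalso; apply: nP; exists n; apply/asboolP.
Qed.

Lemma oaddC a b : oadd a b = oadd b a.
Proof. by case: a b => [m|] [n|] //=; rewrite addnC. Qed.

(** Each nonzero decrement [k m] lowers the finite value [a n]. *)
Lemma oadd_stable (a k : nat -> option nat) :
  (forall n, a n = oadd (k n) (a n.+1)) -> forall n, a n <> None ->
  exists2 d, (n <= d)%N & forall m, (d <= m)%N -> k m = Some 0%N.
Proof.
move=> ak n; case E: (a n) => [p|] // _.
elim/ltn_ind: p n E => p IH n an.
have [h|] := pselect (forall m, (n <= m)%N -> k m = Some 0%N); first by exists n.
move=> /existsNP[m /not_implyP[nm km]].
have am : exists2 q, a m = Some q & (q <= p)%N.
  elim: m nm {km} => [|m IHm]; first by rewrite leqn0 => /eqP <-; exists p.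
  rewrite leq_eqVlt => /orP[/eqP <-|]; first by exists p.
  rewrite ltnS => /IHm[q]; rewrite ak; case: (k m) => // i.
  by case: (a m.+1) => // j [<-] iq; exists j => //; apply: leq_trans iq; exact: leq_addl.
case: am => q; rewrite ak; case: (k m) km => // i i0.
case E: (a m.+1) => [j|] // -[<-] ij.
have jp : (j < p)%N.
  apply: leq_trans ij; rewrite -addn1 addnC leq_add2r lt0n.
  by apply/eqP => i00; apply: i0; rewrite i00.
have [d md hd] := IH j jp m.+1 E.
by exists d => //; apply: leq_trans md; apply: leq_trans nm _.
Qed.

Lemma oadd_const (a k : nat -> option nat) d :
  (forall n, a n = oadd (k n) (a n.+1)) ->
  (forall m, (d <= m)%N -> k m = Some 0%N) ->
  forall m, (d <= m)%N -> a m = a d.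
Proof.
move=> ak kd; elim=> [|m IH]; first by rewrite leqn0 => /eqP ->.
rewrite leq_eqVlt => /orP[/eqP <-//|]; rewrite ltnS => dm.
by rewrite -(IH dm) (ak m) kd //=; case: (a m.+1).
Qed.

Lemma oadd_finite (a k : nat -> option nat) :
  (forall n, a n = oadd (k n) (a n.+1)) ->
  forall n m, (n <= m)%N -> a n <> None -> a m <> None /\ k n <> None.
Proof.
move=> ak n m nm an; split; last by move: an; rewrite ak; case: (k n).
elim: m nm => [|m IH]; first by rewrite leqn0 => /eqP <-.
rewrite leq_eqVlt => /orP[/eqP <-//|]; rewrite ltnS => /IH.
by rewrite ak; case: (k m) => // ?; case: (a m.+1).
Qed.

Lemma qdim_finite_inj (K : fieldType) (V V' : lmodType K) (f : {linear V -> V'})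
    (M N : set V) (M' N' : set V') :
  subspc N -> subspc N' -> (forall x, M x -> M' (f x)) -> subspc M ->
  (forall x, M x -> N' (f x) -> N x) -> qdim M' N' <> None -> qdim M N <> None.
Proof.
move=> sN sN' fM sM fN; case E: (qdim M' N') => [k|] // _ /(qdim_None sN).
move=> /(_ k.+1) [v Mv iv].
suff /(dimgeP _ _ sN') : dimge M' N' k.+1 by rewrite E ltnn.
exists (fun i => f (v i)); first by move=> i ik; apply/fM/Mv.
move=> c Nc; apply: iv; apply: fN; first exact: (subspc_sum c sM Mv).
by rewrite linear_sum; under eq_bigr do rewrite linearZ.
Qed.

Section IterLinear.
Context (K : comNzRingType) (V : lmodType K) (T : {linear V -> V}) (n : nat).

Lemma iter_is_linear : linear (iter n T).
Proof. by move=> a x y; elim: n => //= m ->; rewrite linearP. Qed.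

HB.instance Definition _ := GRing.isLinear.Build K V V _ (iter n T)
  iter_is_linear.

Lemma iter0 : iter n T 0 = 0. Proof. exact: linear0. Qed.
Lemma iterB x y : iter n T (x - y) = iter n T x - iter n T y.
Proof. exact: linearB. Qed.
End IterLinear.

Section Powers.
Context {R : realType} {X : normedModType R[i]}.
Implicit Types (T : {linear X -> X}).

Lemma subspc_set0 : subspc [set 0 : X].
Proof. by split=> // a x y -> ->; rewrite /= scaler0 addr0. Qed.

Lemma subspcI (M N : set X) : subspc M -> subspc N -> subspc (M `&` N).
Proof.
move=> [M0 hM] [N0 hN]; split=> // a x y [Mx Nx] [My Ny].
by split; [exact: hM|exact: hN].
Qed.

Lemma subspc_preimage (f : {linear X -> X}) (M : set X) : subspc M ->
  subspc [set x | M (f x)].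
Proof.
move=> [M0 hM]; split=> [|a x y Mx My]; first by rewrite /= linear0.
by rewrite /= linearP; exact: hM.
Qed.

Lemma subspc_nullsp T n : subspc (nullsp T n).
Proof. exact: (@subspc_preimage (iter n T) _ subspc_set0). Qed.

Lemma subspc_rangesp T n : subspc (rangesp T n).
Proof.
split; first by exists 0 => //; exact: iter0.
by move=> a _ _ [x _ <-] [y _ <-]; exists (a *: x + y) => //; exact: iter_is_linear.
Qed.

Lemma rangesp_iter T n m x : rangesp T m x -> rangesp T (n + m) (iter n T x).
Proof. by move=> [y _ <-]; exists y => //; rewrite iterD. Qed.

Lemma rangesp_img T n x : rangesp T n x -> rangesp T n.+1 (T x).
Proof. by move=> [y _ <-]; exists y. Qed.

Lemma rangesp_anti (T : X -> X) n m : (n <= m)%N -> rangesp T m `<=` rangesp T n.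
Proof.
move=> nm _ [x _ <-]; exists (iter (m - n) T x) => //.
by rewrite -iterD subnKC.
Qed.

Lemma nullsp_mono T n m : (n <= m)%N -> nullsp T n `<=` nullsp T m.
Proof.
move=> nm x Nx; rewrite /nullsp /= -(subnK nm) iterD Nx; exact: iter0.
Qed.

Lemma image_rangesp (T : X -> X) n : T @` rangesp T n = rangesp T n.+1.
Proof.
apply/seteqP; split=> [_ [_ [x _ <-] <-]|_ [x _ <-]]; first by exists x.
by exists (iter n T x) => //; exists x.
Qed.

Definition alpha (T : X -> X) n : option nat :=
  qdim (rangesp T n `&` nullsp T 1) [set 0].
Definition beta (T : X -> X) n : option nat :=
  qdim (rangesp T n) (rangesp T n.+1).

Lemma nullityE T n : nullity (rangesp T n) T = alpha T n. Proof. by []. Qed.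

Lemma defectE T n : defect (rangesp T n) T = beta T n.
Proof. by rewrite /defect image_rangesp. Qed.

Lemma alpha_nullsp T n : qdim (nullsp T n.+1) (nullsp T n) = alpha T n.
Proof.
apply: (qdim_iso (f := iter n T)); try exact: subspc_nullsp.
- exact: subspc_set0.
- by move=> x Nx; split; [exists x|].
- by [].
- move=> _ [[x _ <-] Nx]; exists x; first exact: Nx.
  by rewrite /= subrr.
Qed.

Lemma alphaS T n : alpha T n = oadd (kdim T n) (alpha T n.+1).
Proof.
have s1 := subspcI (subspc_rangesp T n.+1) (subspc_nullsp T 1).
apply: qdim_add => //; first exact: subspc_set0.
- by move=> x ->; exact: subspc0.
- by move=> x [Rx Nx]; split=> //; apply: rangesp_anti Rx.
Qed.

(** The kernel of the surjection [R_n / R_(n+1) -> R_(n+1) / R_(n+2)] induced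
    by [T] is [(R_(n+1) + R_n meet N(T)) / R_(n+1)]. *)
Lemma betaS T n : beta T n = oadd (kdim T n) (beta T n.+1).
Proof.
pose Rn := rangesp T n; pose S := rangesp T n.+1.
have sR : subspc Rn by exact: subspc_rangesp.
have sS : subspc S by exact: subspc_rangesp.
have sN : subspc (Rn `&` nullsp T 1) by apply: subspcI => //; exact: subspc_nullsp.
have sN' : subspc (S `&` nullsp T 1) by apply: subspcI => //; exact: subspc_nullsp.
have SR : S `<=` Rn by exact: rangesp_anti.
pose P := [set x | exists2 y, (Rn `&` nullsp T 1) y & S (x - y)].
have sP : subspc P.
  split=> [|a x y [u Nu Su] [v Nv Sv]].
    by exists 0; rewrite ?subr0; exact: subspc0.
  exists (a *: u + v); first by case: sN => _; apply.
  have -> : a *: x + y - (a *: u + v) = a *: (x - u) + (y - v).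
    by rewrite scalerBr; zabel.
  by case: sS => _; apply.
rewrite oaddC /beta (qdim_add (P := P)) //; last first.
- move=> x [y [Ry _] Sy]; rewrite -[x](subrK y); apply: subspcD => //.
  exact: SR.
- by move=> x Sx; exists 0; rewrite ?subr0 //; exact: subspc0.
congr oadd.
  apply: (qdim_iso (f := T)) => //.
  - exact: subspc_rangesp.
  - by move=> x; exact: rangesp_img.
  - move=> x Rx; split=> [[y [Ry Ny] Sy]|[z _ /= zx]].
      rewrite -[x](subrK y) linearD [T y]Ny addr0; exact: rangesp_img.
    exists (x - iter n.+1 T z).
      split; last by rewrite /nullsp /= linearB -zx subrr.
      by apply: subspcB => //; apply: SR; exists z.
    by exists z => //; zabel.
  - move=> _ [x _ <-]; exists (iter n T x); first by exists x.
    by rewrite subrr; apply: subspc0; exact: subspc_rangesp.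
apply/esym; apply: (qdim_iso (f := idfun)) => //=.
- by move=> x Nx; exists x; rewrite ?subrr //; exact: subspc0.
- by move=> x [Rx Nx]; split=> [[]|].
Qed.

End Powers.

(** * Closed ranges *)

Section ClosedRanges.
Context {R : realType} {X : completeNormedModType R[i]}.
Implicit Types (A T : {linear X -> X}) (M N B G : set X).

Lemma closed_preimage_op A M : continuous A -> closed M -> closed [set x | M (A x)].
Proof. by move=> cA cM; apply: (@preimage_closed _ _ A). Qed.

Lemma closed_set0 : closed [set 0 : X].
Proof.
apply/closedE => x hx; apply/eqP; rewrite -nm_eq0 eq_le nm_ge0 andbT.
apply/ler_addgt0Pr => e /hx[_ ->]; rewrite subr0 add0r; exact: ltW.
Qed.

Lemma iter_continuous T n : continuous T -> continuous (iter n T).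
Proof.
move=> cT; elim: n => [|n IH] x; first exact: cvg_id.
by apply: (@continuous_comp _ _ _ (iter n T) T); [exact: IH|exact: cT].
Qed.

Lemma range_add_set0 A : range_add A [set 0] = range A.
Proof.
apply/seteqP; split=> [y [x /= /subr0_eq ->]|_ [x _ <-]]; first by exists x.
by exists x; rewrite /= subrr.
Qed.

(** Let [H] be [N] plus the span of a basis of a complement of [R(A) + N] in
    [G]. It is closed, meets [R(A) + N] in [N], and [R(A) + H = G]: Neubauer's
    lemma applies. *)
Lemma closed_finite_codim A N G : continuous A -> closed N -> subspc N ->
  closed G -> subspc G -> range_add A N `<=` G ->
  qdim G (range_add A N) <> None -> closed (range_add A N).
Proof.
move=> cA cN sN cG sG BG; set B := range_add A N.
have sB : subspc B by exact: subspc_range_add.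
case E: (qdim G B) => [m|] // _.
have [w [Gw iw sw]] := (qdim_Some _ _ sB).1 E.
pose H := add_span N m w.
have cH : closed H by exact: closed_add_span.
have sH : subspc H by exact: subspc_add_span.
have NB : N `<=` B by exact: range_add_sub.
have BH : B `&` H = N.
  apply/seteqP; split=> [x [Bx [c Nc]]|x Nx]; last first.
    by split; [exact: NB|exact: sub_add_span].
  have cm0 : forall i, (i < m)%N -> c i = 0.
    apply: iw; have := subspcB sB Bx (NB _ Nc).
    by congr B; zabel.
  by move: Nc; rewrite big1 ?subr0 // => i _; rewrite cm0 ?scale0r.
have HG : range_add A H = G.
  apply/seteqP; split=> [x [u [c Nc]]|x /sw[c [u Nu]]]; last first.
    exists u, c.
    by have <- : x - \sum_(i < m) c i *: w i - A u =
      x - A u - \sum_(i < m) c i *: w i by zabel.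
  have -> : x = (x - A u - \sum_(i < m) c i *: w i) + A u + \sum_(i < m) c i *: w i.
    by zabel.
  apply: subspcD => //; last exact: (subspc_sum c sG Gw).
  by apply: subspcD => //; apply: BG; [exact: NB|exact: range_add_range].
apply: (neubauer cA cH sH sB); rewrite ?HG ?BH // => x.
exact: range_add_range.
Qed.

Section PowersOfT.
Context (T : {linear X -> X}) (cT : continuous T).

(** [T^-d (R(T^n))], which for [n >= d] is closed if and only if [R(T^n)]
    is closed in [R(T^d)] for the norm of [R(T^d)]. *)
Definition preranges d n : set X := [set x | rangesp T n (iter d T x)].

Lemma preranges_range_add d n :
  preranges d (n + d) = range_add (iter n T) (nullsp T d).
Proof.
apply/seteqP; split=> [x [y _ yx]|x [y Ny]].
  exists y; rewrite /nullsp /= iterB -iterD addnC yx subrr //.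
exists y => //; move: Ny; rewrite /nullsp /= iterB -iterD addnC.
by move/subr0_eq.
Qed.

Lemma subspc_preranges d n : subspc (preranges d n).
Proof. exact: (@subspc_preimage _ _ (iter d T) _ (subspc_rangesp T n)). Qed.

Lemma closed_nullsp n : closed (nullsp T n).
Proof.
exact: (@closed_preimage_op (iter n T) _ (iter_continuous (n := n) cT) closed_set0).
Qed.

Lemma closed_in_normP d n : (d <= n)%N ->
  closed_in_norm (range_norm T d) (rangesp T d) (rangesp T n) <->
  closed (preranges d n).
Proof.
move=> dn; split=> [h|/closedE h y [x _ xy] hy].
  apply/closedE => x hx; apply: h; first by exists x.
  move=> e /hx[z Qz xz]; exists (iter d T z) => //.
  apply: le_lt_trans xz; apply: ge_inf.
    by exists 0 => _ [u _ <-]; exact: nm_ge0.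
  by exists (x - z) => //=; rewrite iterB.
rewrite -xy; apply: h => e /hy[z Rz yz].
have [z0 _ z0z] := rangesp_anti dn Rz.
pose S := [set nm u | u in [set u | y - z = iter d T u]].
have {}yz : inf S < e := yz.
have hS : has_inf S.
  split; last by exists 0 => _ [u _ <-]; exact: nm_ge0.
  by exists (nm (x - z0)); exists (x - z0); rewrite //= iterB xy z0z.
have e0 : 0 < e - inf S by rewrite subr_gt0.
have [_ [u /= uy <-] ue] := inf_adherent e0 hS.
exists (x - u); last by rewrite opprB addrCA subrr addr0; move: ue; rewrite addrC subrK.
rewrite /preranges /= iterB xy -uy.
by have -> : y - (y - z) = z by zabel.
Qed.

(** [T^(n+1)] is open onto its closed range, so [R(T^(n+2))] is closed as soon
    as its preimage [R(T) + N(T^(n+1))] is. The latter exceeds the closed set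
    [R(T) + N(T^n)], the preimage of [R(T^(n+1))] under [T^n], by [k_n]
    dimensions. *)
Lemma closed_rangespS n : kdim T n <> None -> closed (rangesp T n.+1) ->
  closed (rangesp T n.+2).
Proof.
move=> kn cR; pose H := range_add T (nullsp T n.+1).
have cG : closed (range_add (iter n.+1 T) [set 0]) by rewrite range_add_set0.
have [C C0 hC] := open_mapping (iter_continuous (n := n.+1) cT) closed_set0
  (@subspc_set0 _ _) cG.
rewrite range_add_set0 in hC.
have cQ : closed (range_add T (nullsp T n)).
  rewrite -(preranges_range_add n 1) add1n.
  exact: (@closed_preimage_op (iter n T) _ (iter_continuous (n := n) cT) cR).
have sQ : subspc (range_add T (nullsp T n)).
  by apply: subspc_range_add; exact: subspc_nullsp.
have cH : closed H.
  apply: (closed_qdim cQ sQ).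
  - by apply: subspc_range_add; exact: subspc_nullsp.
  - by move=> x [u Nu]; exists u; exact: (nullsp_mono (leqnSn n)).
  move: kn; rewrite /kdim; set M := _ `&` _; set N := _ `&` _.
  have sN : subspc N by apply: subspcI; [exact: subspc_rangesp|exact: subspc_nullsp].
  case E: (qdim M N) => [m|] // _.
  have [v [Mv _ sv]] := (qdim_Some _ _ sN).1 E.
  have /choice[s hs] i : exists s, (i < m)%N -> v i = iter n T s.
    by have [/Mv[[s _ <-] _]|_] := boolP (i < m)%N; [exists s|exists 0].
  apply: (qdim_finite (m := m) (w := s) sQ) => x [u Nu].
  have /sv[c [[b _ bE] _]] : M (iter n T (x - T u)) by split; [exists (x - T u)|].
  exists c, (u + b); rewrite /nullsp /= (linearD T).
  have -> : x - \sum_(i < m) c i *: s i - (T u + T b) =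
     (x - T u) - \sum_(i < m) c i *: s i - T b by zabel.
  rewrite 2!iterB -iterSr bE (linear_sum (iter n T)).
  under [X in _ - X - _]eq_bigr do rewrite linearZ /= -hs //.
  by rewrite subrr.
apply/closedE => y hy.
have [u _ uy] : rangesp T n.+1 y.
  by apply: (closedE _).1 => // e /hy[z Rz yz]; exists z => //; exact: rangesp_anti Rz.
suff [x Nx] : H u.
  exists x => //; rewrite iterSr -uy; apply/esym/subr0_eq; rewrite -iterB; exact: Nx.
apply: (closedE H).1 => // e e0.
have [z [q _ qz] yz] := hy _ (divr_gt0 e0 C0).
have [w wC w0] : exists2 w, nm w <= C * nm (y - z) & [set 0] (y - z - iter n.+1 T w).
  apply: hC; exists (u - T q) => //.
  by transitivity (iter n.+1 T u - iter n.+2 T q);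
    [rewrite (iterSr n.+1) -iterB|rewrite uy qz].
exists (u - w).
  exists q; transitivity (y - z - iter n.+1 T w); last exact: w0.
  by rewrite 2!(iterB T n.+1) -iterSr uy qz; zabel.
have -> : u - (u - w) = w by zabel.
by apply: le_lt_trans wC _; rewrite mulrC -ltr_pdivlMr.
Qed.

Definition kzero d := forall n, (d <= n)%N -> kdim T n = Some 0%N.

Lemma kzero_closed d n : kzero d -> (d < n)%N -> closed (rangesp T d.+1) ->
  closed (rangesp T n).
Proof.
move=> kd; case: n => // n; rewrite ltnS; elim: n => [|n IH].
  by rewrite leqn0 => /eqP ->.
rewrite leq_eqVlt => /orP[/eqP <-//|dn] cR; apply: closed_rangespS.
  by rewrite kd.
exact: IH.
Qed.

Definition tud_at d := kzero d /\ forall n, (d <= n)%N -> closed (preranges d n).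

Lemma TUDP : TUD T <-> exists d, tud_at d.
Proof.
by split=> -[d [kd cd]]; exists d; split=> // n dn; apply/closed_in_normP => //; exact: cd.
Qed.

Lemma preranges_id d : preranges d d = setT.
Proof. by apply/seteqP; split=> // x _; exists x. Qed.

Lemma quasi_fredholm_tud d : kzero d -> closed (rangesp T d.+1) -> tud_at d.
Proof.
move=> kd cR; split=> // n; rewrite leq_eqVlt => /orP[/eqP <-|dn].
  by rewrite preranges_id; exact: closedT.
apply: (@closed_preimage_op (iter d T) _ (iter_continuous (n := d) cT)).
exact: kzero_closed cR.
Qed.

Lemma quasi_fredholm_TUD : quasi_fredholm T -> TUD T.
Proof. by move=> [d [kd cR]]; apply/TUDP; exists d; exact: quasi_fredholm_tud. Qed.

Lemma qdim_rangesp_finite d j : beta T d <> None ->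
  qdim (rangesp T d) (rangesp T (j + d)) <> None.
Proof.
move=> bd; elim: j => [|j IH].
  by rewrite (qdim_eq0 _ (subspc_rangesp T d)).2.
rewrite (qdim_add (P := rangesp T (j + d))); try exact: subspc_rangesp.
- have [bj _] := oadd_finite (betaS T) (leq_addl j d) bd.
  rewrite addSn -/(beta T (j + d)).
  by case: (qdim _ _) IH => // ? _; case: (beta T _) bj.
- by apply: rangesp_anti; rewrite leq_add2r.
- exact/rangesp_anti/leq_addl.
Qed.

(** [T^-d (R(T^n))] is an operator range modulo [N(T^d)], and its codimension is
    that of [R(T^n)] in [R(T^d)]. *)
Lemma finite_beta_TUD d : beta T d <> None -> TUD T.
Proof.
move=> bd; have [d' dd' kd'] := oadd_stable (betaS T) bd.
have [bd' _] := oadd_finite (betaS T) dd' bd.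
apply/TUDP; exists d'; split=> // n dn.
rewrite -(subnK dn) preranges_range_add.
apply: (closed_finite_codim (G := setT)); rewrite ?subsetT //.
- exact: iter_continuous.
- exact: closed_nullsp.
- exact: subspc_nullsp.
rewrite -preranges_range_add.
have <- : qdim (rangesp T d') (rangesp T (n - d' + d')) =
  qdim [set: X] (preranges d' (n - d' + d')).
  apply/esym; apply: (qdim_iso (f := iter d' T)) => //; try exact: subspc_rangesp.
  - exact: subspc_preranges.
  - by move=> x _; exists x.
  - by move=> _ [x _ <-]; exists x => //=; rewrite subrr; apply: subspc0; exact: subspc_rangesp.
exact: qdim_rangesp_finite.
Qed.

Lemma finite_beta_closed d m : beta T d <> None -> closed (rangesp T d) ->
  (d <= m)%N -> closed (rangesp T m).
Proof.
move=> bd cR dm; rewrite -[rangesp T m]range_add_set0.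
apply: (closed_finite_codim (G := rangesp T d)) => //; rewrite ?range_add_set0.
- exact: iter_continuous.
- exact: closed_set0.
- exact: subspc_set0.
- exact: subspc_rangesp.
- exact: rangesp_anti.
- by rewrite -/(rangesp T m) -(subnK dm); exact: qdim_rangesp_finite.
Qed.

Lemma finite_beta_quasi_fredholm d : beta T d <> None ->
  closed (rangesp T d) -> quasi_fredholm T.
Proof.
move=> bd cR; have [d' dd' kd'] := oadd_stable (betaS T) bd.
exists d'; split=> //; apply: (finite_beta_closed bd cR).
exact: leq_trans (leqnSn _).
Qed.

Lemma finite_alpha_closed d m : alpha T d <> None -> closed (rangesp T d.+1) ->
  (d < m)%N -> closed (rangesp T m).
Proof.
move=> ad cR; case: m => // m; rewrite ltnS; elim: m => [|m IH].
  by rewrite leqn0 => /eqP <-.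
rewrite leq_eqVlt => /orP[/eqP <-//|]; rewrite ltnS => dm.
apply: closed_rangespS; last exact: IH.
by have [/(oadd_finite (alphaS T) (leqnn m))[_]] := oadd_finite (alphaS T) dm ad.
Qed.

Lemma finite_alpha_quasi_fredholm d : alpha T d <> None ->
  closed (rangesp T d.+1) -> quasi_fredholm T.
Proof.
move=> ad cR; have [d' dd' kd'] := oadd_stable (alphaS T) ad.
by exists d'; split=> //; apply: (finite_alpha_closed ad cR).
Qed.

(** [T^j] embeds the quotients of consecutive kernels of powers into
    [R(T^(j+m))] meet [N(T)]. *)
Lemma finite_alpha_qdim d m : alpha T m <> None ->
  qdim (rangesp T m `&` nullsp T d) [set 0] <> None.
Proof.
move=> am; elim: d => [|d IH].
  suff -> : qdim (rangesp T m `&` nullsp T 0) [set 0] = Some 0%N by [].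
  by apply/(qdim_eq0 _ (@subspc_set0 _ _)) => x [].
have sM n : subspc (rangesp T m `&` nullsp T n).
  by apply: subspcI; [exact: subspc_rangesp|exact: subspc_nullsp].
rewrite (qdim_add (P := rangesp T m `&` nullsp T d)) //; last 3 first.
- exact: subspc_set0.
- by move=> x ->; exact: subspc0.
- by move=> x [Rx Nx]; split=> //; exact: (nullsp_mono (leqnSn d)).
have : qdim (rangesp T m `&` nullsp T d.+1) (rangesp T m `&` nullsp T d) <> None.
  have [ad _] := oadd_finite (alphaS T) (leq_addl d m) am.
  apply: (qdim_finite_inj (f := iter d T)) ad => //.
  - exact: subspc_set0.
  - by move=> x [Rx Nx]; split; [exact: rangesp_iter|exact: Nx].
  - by move=> x [Rx _] /= x0.
by case: (qdim _ (_ `&` _)) => // ? _; case: (qdim _ [set 0]) IH.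
Qed.

(** [R(T^m) + N(T^d)] is closed by uniform descent and [R(T^m)] meets [N(T^d)] in
    finite dimension, so that Neubauer's lemma applies. *)
Lemma tud_finite_alpha_closed d m : tud_at d -> alpha T m <> None ->
  closed (rangesp T m).
Proof.
move=> [_ cd] am.
have cG : closed (range_add (iter m T) (nullsp T d)).
  by rewrite -preranges_range_add; apply: cd; exact: leq_addl.
apply: (@neubauer _ _ (iter m T) (nullsp T d) (rangesp T m)
  (iter_continuous (n := m) cT) (@closed_nullsp d) (subspc_nullsp T d)
  (subspc_rangesp T m) cG).
- by move=> x; exists x.
- move=> _ [x _ <-]; apply: range_add_range; exact: subspc_nullsp.
- apply: (closed_qdim closed_set0 (@subspc_set0 _ _)).
  + by apply: subspcI; [exact: subspc_rangesp|exact: subspc_nullsp].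
  + move=> x ->; split; apply: subspc0; [exact: subspc_rangesp|exact: subspc_nullsp].
  + exact: finite_alpha_qdim.
Qed.

Lemma finite_beta_closed_down p n : (p <= n)%N -> beta T p <> None ->
  closed (rangesp T n) -> closed (rangesp T p).
Proof.
move=> pn bp cR; apply: (closed_qdim cR); try exact: subspc_rangesp.
  exact: rangesp_anti.
by rewrite -(subnK pn); exact: qdim_rangesp_finite.
Qed.

End PowersOfT.

End ClosedRanges.

(** * The punctured neighbourhood theorem *)

Section Punctured.
Context {R : realType} {X : completeNormedModType R[i]}.
Context (T : {linear X -> X}) (cT : continuous T).

(** By [k_n = 0], the intersection of [N(T)] with [R(T^n)] is the same for all
    [n >= d]. *)
Lemma kzero_ker_sub d n x : kzero T d -> (d <= n)%N ->
  rangesp T d x -> T x = 0 -> rangesp T n x.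
Proof.
move=> kd dn Rx Tx; elim: n dn => [|n IH]; first by rewrite leqn0 => /eqP <-.
rewrite leq_eqVlt => /orP[/eqP <-//|]; rewrite ltnS => dn.
have s1 : subspc (rangesp T n.+1 `&` nullsp T 1).
  by apply: subspcI; [exact: subspc_rangesp|exact: subspc_nullsp].
have /(qdim_eq0 _ s1) h := kd n dn.
by have [] : (rangesp T n.+1 `&` nullsp T 1) x by apply: h; split=> //; exact: IH.
Qed.

Lemma nullsp_shift n (a : R[i]) x : a != 0 -> nullsp T n x ->
  exists2 y, nullsp T n y & x = shiftop T a y.
Proof.
move=> a0; elim: n x => [|n IH] x Nx.
  exists 0; first exact: subspc0 (subspc_nullsp T 0).
  by rewrite linear0; exact: Nx.
have /IH[y Ny Txy] : nullsp T n (T x) by rewrite /nullsp /= -iterSr.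
exists (a^-1 *: (y - x)).
  apply: subspcZ; first exact: subspc_nullsp.
  apply: subspcB => //; first exact: subspc_nullsp.
  exact: (nullsp_mono (leqnSn n)).
rewrite shiftZ shiftB -Txy /shiftop.
have -> : T x - (T x - a *: x) = a *: x by zabel.
by rewrite scalerA mulVf // scale1r.
Qed.

Lemma nullsp_eigen n (a : R[i]) x : a != 0 -> nullsp T n x ->
  shiftop T a x = 0 -> x = 0.
Proof.
move=> a0 Nx /subr0_eq Tx.
have it : iter n T x = a ^+ n *: x.
  elim: n {Nx} => [|n IH]; first by rewrite expr0 scale1r.
  by rewrite iterS IH linearZ /= Tx scalerA -exprSr.
move: Nx; rewrite /nullsp /= it => /eqP.
by rewrite scaler_eq0 expf_eq0 (negPf a0) andbF => /eqP.
Qed.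

(** With [N = N(T^d)] and [Z] the preimage under [T^d] of the intersection of
    all [R(T^n)], uniform descent makes [T] semi-regular modulo [N]; and
    [T - a] maps [N] onto itself bijectively if [a != 0], so that what holds
    modulo [N] holds outright. *)
Lemma punctured_neighbourhood d : tud_at T d -> exists2 r : R, 0 < r &
  forall a : R[i], a != 0 -> cn a <= r ->
    [/\ kzero (shiftop T a) 0, closed (rangesp (shiftop T a) 1),
        alpha (shiftop T a) 0 = alpha T d & beta (shiftop T a) 0 = beta T d].
Proof.
move=> [kd cd]; pose N := nullsp T d.
pose Z := [set x | forall n, rangesp T n (iter d T x)].
have sN : subspc N by exact: subspc_nullsp.
have cN : closed N by exact: closed_nullsp.
have sZ : subspc Z.
  split=> [n|a x y Zx Zy n]; first exact: (subspc0 (subspc_preranges T d n)).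
  by have [_] := subspc_preranges T d n; apply; [exact: Zx|exact: Zy].
have cZ : closed Z.
  apply/closedE => x hx n; apply: (rangesp_anti (leq_maxl n d)).
  apply: (closedE _).1 (cd _ (leq_maxr n d)) _ _ => e /hx[z Zz xz].
  by exists z => //; exact: Zz.
have NZ : N `<=` Z.
  by move=> x Nx n; rewrite Nx; exact: subspc0 (subspc_rangesp T n).
have TN x : N x -> N (T x).
  by move=> Nx; rewrite /N /nullsp /= -iterSr /= Nx linear0.
have TZ x : Z (T x) <-> Z x.
  split=> Zx n; last first.
    by rewrite -iterSr /=; apply: (rangesp_anti (leqnSn n)); apply: rangesp_img.
  pose m := maxn n d; apply: (rangesp_anti (leq_maxl n d)).
  have [w _ ww] := Zx m.+1.
  rewrite -/m -[iter d T x](subrK (iter m T w)).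
  apply: subspcD; [exact: subspc_rangesp| |by exists w].
  apply: (kzero_ker_sub kd (leq_maxr n d)).
    apply: subspcB; [exact: subspc_rangesp|by exists x|].
    by apply: (rangesp_anti (leq_maxr n d)); exists w.
  by rewrite linearB -iterS -iterS ww -iterSr subrr.
have GE : preranges T d d.+1 = range_add T N.
  by rewrite -add1n preranges_range_add.
have ZR : Z `<=` range_add T N by move=> x Zx; rewrite -GE; exact: Zx.
have cG : closed (range_add T N) by rewrite -GE; exact: cd.
have [C C0 liftC] := open_mapping cT cN sN cG.
exists (half / C); first by rewrite divr_gt0.
move=> a a0 ar; have Ca : C * cn a <= half by move: ar; rewrite ler_pdivlMr // mulrC.
pose S := shiftop T a.
have NS x : N x -> exists2 y, N y & x = S y by exact: nullsp_shift.
have ZS x : Z x -> exists2 y, Z y & x = S y.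
  move=> /(shift_lift cT cN sN cZ sZ NZ TZ ZR liftC Ca)[z [Zz _ /NS[y Ny xz]]].
  exists (y + z); first by exact: (subspcD sZ (NZ _ Ny) Zz).
  by rewrite /S shiftD -/S -xz subrK.
have ZSn n x : Z x -> rangesp S n x.
  move=> Zx; suff [y _ ->] : exists2 y, Z y & x = iter n S y by exists y.
  elim: n => [|n [y /ZS[z Zz ->] ->]]; first by exists x.
  by exists z => //; rewrite iterSr.
have kerZ : [set x | N (S x)] `<=` Z.
  exact: (shift_ker_sub sN cZ sZ NZ TZ ZR C0 liftC Ca).
have sS0 n : subspc (rangesp S n `&` nullsp S 1).
  by apply: subspcI; [exact: subspc_rangesp|exact: subspc_nullsp].
have rS1 : rangesp S 1 = range_add S N.
  apply/seteqP; split=> [_ [x _ <-]|x [y /NS[z Nz xy]]]; first exact: range_add_range.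
  by exists (z + y) => //=; rewrite /S shiftD -/S -xy subrK.
have rS0 : rangesp S 0 = setT by apply/seteqP; split=> // x _; exists x.
split.
- move=> n _; apply/(qdim_eq0 _ (sS0 n.+1)) => x [_ Sx]; split=> //; apply: ZSn.
  by apply: kerZ; rewrite /= [S x]Sx; exact: subspc0.
- rewrite -/S rS1.
  exact: (shift_closed cT cN sN cZ sZ NZ TZ ZR C0 liftC Ca).
- transitivity (qdim [set x | N (S x)] N); last first.
    rewrite -(shift_ker_dim cT cN sN cZ sZ NZ TN TZ ZR C0 liftC ar) -alpha_nullsp.
    congr (qdim _ N); apply/seteqP.
    by split=> x; rewrite /N /nullsp /= -iterS iterSr.
  apply: (qdim_iso (f := idfun)) => //; first exact: subspc_set0.
  + by move=> x [_ Sx]; rewrite /= [S x]Sx; exact: subspc0.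
  + move=> x [_ Sx]; split=> [->|Nx]; first exact: subspc0.
    exact: nullsp_eigen Nx Sx.
  + move=> y /= /NS[z Nz Syz]; exists (y - z).
      by rewrite rS0; split=> //; rewrite /nullsp /= /S shiftB -/S Syz subrr.
    by have -> : y - (y - z) = z by zabel.
- rewrite /beta -/S rS0 rS1.
  rewrite -(shift_coker_dim cT cN sN cZ sZ NZ TZ ZR C0 liftC ar) -GE.
  apply: (qdim_iso (f := iter d T)) => //; try exact: subspc_rangesp.
  + exact: subspc_preranges.
  + by move=> x _; exists x.
  + move=> _ [x _ <-]; exists x => //=.
    by rewrite subrr; apply: subspc0; exact: subspc_rangesp.
Qed.

End Punctured.

(** * The classes of operators under uniform descent *)

Section Classes.
Context {R : realType} {X : completeNormedModType R[i]}.
Context (T : {linear X -> X}) (cT : continuous T).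

Lemma ess_ascentE : ess_ascent T = nat_inf [set n | alpha T n <> None].
Proof. by congr nat_inf; apply/seteqP; split=> n /=; rewrite alpha_nullsp. Qed.

Lemma ascentE : ascent T = nat_inf [set n | alpha T n = Some 0%N].
Proof.
congr nat_inf; apply/seteqP; split=> n /=; rewrite -alpha_nullsp.
  by move=> E; apply/(qdim_eq0 _ (subspc_nullsp T n)); rewrite -E.
move/(qdim_eq0 _ (subspc_nullsp T n)) => h; apply/seteqP; split=> //.
exact: nullsp_mono.
Qed.

Lemma descentE : descent T = nat_inf [set n | beta T n = Some 0%N].
Proof.
congr nat_inf; apply/seteqP; split=> n /=.
  by move=> E; apply/(qdim_eq0 _ (subspc_rangesp T n.+1)); rewrite -E.
move/(qdim_eq0 _ (subspc_rangesp T n.+1)) => h; apply/seteqP; split=> //.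
exact: rangesp_anti.
Qed.

Lemma closed_image_subspace n : closed (rangesp T n) ->
  closed (T @` rangesp T n : set (subspace (rangesp T n))) ->
  closed (rangesp T n.+1).
Proof.
move=> cR; rewrite image_rangesp -(closed_setIS _ cR).
congr closed; apply/seteqP; split=> [x []//|x Rx]; split=> //.
exact: rangesp_anti Rx.
Qed.

(** As [alpha n = k_n + alpha (n+1)] and [beta n = k_n + beta (n+1)], the
    difference does not depend on [n], as soon as it is defined. *)
Lemma index_const n m : (n <= m)%N -> semi_fredholm (rangesp T n) T ->
  Defs.index (rangesp T n) T = (enat (alpha T m) - enat (beta T m))%E.
Proof.
move=> nm; rewrite /Defs.index nullityE defectE => sf.
have {sf} : alpha T n <> None \/ beta T n <> None.
  by case: sf => [[h _]|h]; [left|right; rewrite -defectE].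
elim: m nm => [|m IH]; first by rewrite leqn0 => /eqP ->.
rewrite leq_eqVlt => /orP[/eqP ->//|]; rewrite ltnS => nm h.
rewrite IH //.
have {h} : alpha T m <> None \/ beta T m <> None.
  case: h => h; [left|right].
    by have [] := oadd_finite (alphaS T) nm h.
  by have [] := oadd_finite (betaS T) nm h.
rewrite (alphaS T m) (betaS T m).
case: (kdim T m) => [k|]; last by case.
case: (alpha T m.+1) => [a|]; case: (beta T m.+1) => [b|] //=.
by move=> _; rewrite -!EFinD !PoszD opprD addrACA subrr add0r.
Qed.

Section Level.
Variable d : nat.
Hypothesis kd : kzero T d.
Notation a := (alpha T d).
Notation b := (beta T d).

Lemma alpha_const n : (d <= n)%N -> alpha T n = a.
Proof. exact: (oadd_const (alphaS T) kd). Qed.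

Lemma beta_const n : (d <= n)%N -> beta T n = b.
Proof. exact: (oadd_const (betaS T) kd). Qed.

Lemma alpha_finite n : alpha T n <> None -> a <> None.
Proof.
move=> /(oadd_finite (alphaS T) (leq_maxl n d))[].
by rewrite alpha_const ?leq_maxr.
Qed.

Lemma beta_finite n : beta T n <> None -> b <> None.
Proof.
move=> /(oadd_finite (betaS T) (leq_maxl n d))[].
by rewrite beta_const ?leq_maxr.
Qed.

Lemma oadd_eq0 (f k : nat -> option nat) n m :
  (forall i, f i = oadd (k i) (f i.+1)) -> (n <= m)%N ->
  f n = Some 0%N -> f m = Some 0%N.
Proof.
move=> fk nm fn; elim: m nm => [|m IH]; first by rewrite leqn0 => /eqP n0; move: fn; rewrite n0.
rewrite leq_eqVlt => /orP[/eqP <-//|]; rewrite ltnS => /IH; rewrite fk.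
case: (k m) => // i; case: (f m.+1) => // j /= [/eqP].
by rewrite addn_eq0 => /andP[_ /eqP ->].
Qed.

Lemma alpha_zero n : alpha T n = Some 0%N -> a = Some 0%N.
Proof.
move=> /(oadd_eq0 (alphaS T) (leq_maxl n d)).
by rewrite alpha_const ?leq_maxr.
Qed.

Lemma beta_zero n : beta T n = Some 0%N -> b = Some 0%N.
Proof.
move=> /(oadd_eq0 (betaS T) (leq_maxl n d)).
by rewrite beta_const ?leq_maxr.
Qed.

Lemma B_indexE n : closed (rangesp T n) -> semi_fredholm (rangesp T n) T ->
  B_index T = (enat a - enat b)%E.
Proof.
move=> cR sf; rewrite /B_index; case E: nat_inf => [m|]; last first.
  have : nat_inf [set n | closed (rangesp T n) /\ semi_fredholm (rangesp T n) T]
    <> None by apply/nat_inf_finite; exists n.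
  by rewrite E.
have [[_ sf'] _] := nat_inf_Some E.
rewrite (index_const (leq_maxl m d) sf').
by rewrite alpha_const ?beta_const ?leq_maxr.
Qed.

Lemma finite_descentE : finite_descent T <-> b = Some 0%N.
Proof.
rewrite /finite_descent descentE nat_inf_finite.
by split=> [[n /beta_zero]|bd]; last exists d.
Qed.

Lemma finite_ess_descentE : finite_ess_descent T <-> b <> None.
Proof.
rewrite /finite_ess_descent nat_inf_finite.
by split=> [[n /beta_finite]|bd]; last exists d.
Qed.

Lemma drazinE : drazin T <-> a = Some 0%N /\ b = Some 0%N.
Proof.
rewrite /drazin -finite_descentE ascentE nat_inf_finite.
by split=> -[h ?]; split=> //; [have [n /alpha_zero] := h|exists d].
Qed.

Section UniformDescent.
Hypothesis td : tud_at T d.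

Lemma left_ess_drazinE : left_ess_drazin T <-> a <> None.
Proof.
rewrite /left_ess_drazin ess_ascentE; split=> [[p /nat_inf_Some[ap _] _]|ad].
  exact: alpha_finite ap.
case E: nat_inf => [p|]; last by case: ((nat_inf_finite _).2 _ E); exists d.
exists p => //; apply: (tud_finite_alpha_closed cT td).
have [ap _] := nat_inf_Some E.
by have [] := oadd_finite (alphaS T) (leqnSn p) ap.
Qed.

Lemma left_drazinE : left_drazin T <-> a = Some 0%N.
Proof.
rewrite /left_drazin ascentE; split=> [[p /nat_inf_Some[ap _] _]|ad].
  exact: alpha_zero ap.
case E: nat_inf => [p|]; last by case: ((nat_inf_finite _).2 _ E); exists d.
exists p => //; apply: (tud_finite_alpha_closed cT td).
have [ap _] := nat_inf_Some E.
have ap' : alpha T p <> None by rewrite ap.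
by have [] := oadd_finite (alphaS T) (leqnSn p) ap'.
Qed.

Lemma upper_semi_fredholm_at : a <> None ->
  closed (rangesp T d) /\ upper_semi_fredholm (rangesp T d) T.
Proof.
move=> ad; have cd n : (d <= n)%N -> closed (rangesp T n).
  by move=> dn; apply: (tud_finite_alpha_closed cT td); rewrite alpha_const.
split; first exact: cd.
split=> //; rewrite image_rangesp; apply: closed_subspaceW; exact: cd.
Qed.

Lemma upper_semi_B_fredholmE : upper_semi_B_fredholm T <-> a <> None.
Proof.
split=> [[n cR [an _]]|ad]; first exact: alpha_finite an.
by have [cR uf] := upper_semi_fredholm_at ad; exists d.
Qed.

Lemma B_fredholmE : B_fredholm T <-> a <> None /\ b <> None.
Proof.
split=> [[n cR [[an _]]]|[ad bd]].
  by rewrite /lower_semi_fredholm defectE => /beta_finite; split=> //; exact: alpha_finite an.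
have [cR uf] := upper_semi_fredholm_at ad; exists d => //; split=> //.
by rewrite /lower_semi_fredholm defectE.
Qed.

Lemma B_weylE : B_weyl T <-> (a <> None /\ b <> None) /\ (enat a - enat b = 0)%E.
Proof.
rewrite /B_weyl B_fredholmE.
split=> -[[ad bd]]; have [cR uf] := upper_semi_fredholm_at ad;
  by rewrite (B_indexE cR (or_introl uf)).
Qed.

Lemma upper_semi_B_weylE :
  upper_semi_B_weyl T <-> a <> None /\ (enat a - enat b <= 0)%E.
Proof.
rewrite /upper_semi_B_weyl upper_semi_B_fredholmE.
split=> -[ad]; have [cR uf] := upper_semi_fredholm_at ad;
  by rewrite (B_indexE cR (or_introl uf)).
Qed.

End UniformDescent.

Section QuasiFredholm.
Hypothesis cR : closed (rangesp T d.+1).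

Lemma right_ess_drazinE : right_ess_drazin T <-> b <> None.
Proof.
split=> [[p /nat_inf_Some[bp _] _]|bd]; first exact: beta_finite bp.
have : ess_descent T <> None by apply/finite_ess_descentE.
rewrite /right_ess_drazin; case E: ess_descent => [p|] // _; exists p => //.
have [bp _] := nat_inf_Some E.
apply: (finite_beta_closed_down (n := maxn p d.+1)) => //; first exact: leq_maxl.
by apply: (kzero_closed cT kd) => //; exact: leq_maxr.
Qed.

Lemma right_drazinE : right_drazin T <-> b = Some 0%N.
Proof.
rewrite /right_drazin descentE.
split=> [[p /nat_inf_Some[bp _] _]|bd]; first exact: beta_zero bp.
case E: nat_inf => [p|]; last by case: ((nat_inf_finite _).2 _ E); exists d.
exists p => //; have [bp _] := nat_inf_Some E.
apply: (finite_beta_closed_down (n := maxn p d.+1)); first exact: leq_maxl.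
  by rewrite bp.
by apply: (kzero_closed cT kd) => //; exact: leq_maxr.
Qed.

Lemma lower_semi_B_weylE :
  lower_semi_B_weyl T <-> b <> None /\ (0 <= enat a - enat b)%E.
Proof.
have lf n : beta T n <> None -> semi_fredholm (rangesp T n) T.
  by move=> bn; right; rewrite /lower_semi_fredholm defectE.
split=> [[[n cn +] bi]|[bd ab]].
  rewrite /lower_semi_fredholm defectE => bn; split; first exact: beta_finite bn.
  by rewrite -(B_indexE cn (lf _ bn)).
have bd' : beta T d.+1 <> None by rewrite beta_const.
split; last by rewrite (B_indexE cR (lf _ bd')).
by exists d.+1 => //; rewrite /lower_semi_fredholm defectE.
Qed.

End QuasiFredholm.

End Level.

Lemma left_ess_drazin_qf : left_ess_drazin T -> quasi_fredholm T.
Proof.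
rewrite /left_ess_drazin ess_ascentE => -[p /nat_inf_Some[ap _] cR].
exact: (finite_alpha_quasi_fredholm cT ap).
Qed.

Lemma left_drazin_qf : left_drazin T -> quasi_fredholm T.
Proof.
rewrite /left_drazin ascentE => -[p /nat_inf_Some[ap _] cR].
by apply: (finite_alpha_quasi_fredholm cT (d := p)); rewrite ?ap.
Qed.

Lemma upper_semi_B_fredholm_qf : upper_semi_B_fredholm T -> quasi_fredholm T.
Proof.
move=> [n cR [an cR']]; apply: (finite_alpha_quasi_fredholm cT an).
exact: closed_image_subspace.
Qed.

Lemma lower_semi_B_fredholm_qf : lower_semi_B_fredholm T -> quasi_fredholm T.
Proof.
move=> [n cR]; rewrite /lower_semi_fredholm defectE => bn.
exact: (finite_beta_quasi_fredholm cT bn).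
Qed.

Lemma right_ess_drazin_qf : right_ess_drazin T -> quasi_fredholm T.
Proof.
by move=> [p /nat_inf_Some[bp _] cR]; exact: (finite_beta_quasi_fredholm cT bp).
Qed.

Lemma right_drazin_qf : right_drazin T -> quasi_fredholm T.
Proof.
rewrite /right_drazin descentE => -[p /nat_inf_Some[bp _] cR].
by apply: (finite_beta_quasi_fredholm cT (d := p)); rewrite ?bp.
Qed.

Lemma finite_ess_descent_TUD : finite_ess_descent T -> TUD T.
Proof. by move=> /nat_inf_finite[n bn]; exact: (finite_beta_TUD cT bn). Qed.

Lemma finite_descent_TUD : finite_descent T -> TUD T.
Proof.
rewrite /finite_descent descentE => /nat_inf_finite[n bn].
by apply: (finite_beta_TUD cT (d := n)); rewrite bn.
Qed.

Lemma B_fredholm_qf : B_fredholm T -> quasi_fredholm T.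
Proof. by move=> [n cR [uf _]]; apply: upper_semi_B_fredholm_qf; exists n. Qed.

End Classes.

(** * Boundaries of the spectra *)

Section Boundary.
Context {R : realType} {X : completeNormedModType R[i]}.
Implicit Types (T S : {linear X -> X}) (P U : (X -> X) -> Prop).

Definition quasi_fredholm_at T d := kzero T d /\ closed (rangesp T d.+1).

Lemma nbhs_cnP (x : R[i]^o) (A : set R[i]^o) :
  nbhs x A <-> exists2 e : R, 0 < e & forall y, cn (x - y) < e -> A y.
Proof. exact: (@nbhs_nmP R R[i]^o). Qed.

(** A class [P] contained in [U], membership in which is decided by the
    eventual values of [alpha] and [beta] for operators in [U], is locally
    constant at the points outside the spectrum of [U]; no such point is a
    boundary point of the spectrum of [P]. *)
Lemma boundary_sub P U (at_ : {linear X -> X} -> nat -> Prop)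
    (Q : option nat -> option nat -> Prop) :
  (forall S, continuous S -> U S -> exists d, at_ S d) ->
  (forall S d, continuous S -> at_ S d -> tud_at S d) ->
  (forall S d, continuous S -> quasi_fredholm_at S d -> at_ S d) ->
  (forall S d, continuous S -> at_ S d -> P S <-> Q (alpha S d) (beta S d)) ->
  (forall S, continuous S -> P S -> U S) ->
  forall T, continuous T ->
  boundary (spectrum_of P T) `<=` boundary (spectrum_of U T).
Proof.
move=> Uat at_tud qf_at PQ PU T cT l [clP intP].
have csh a : continuous (shiftop T a) by exact: shift_continuous.
have UP : spectrum_of U T `<=` spectrum_of P T.
  by move=> a nU Pa; apply: nU; exact: (PU _ (csh a) Pa).
split; last by move=> /(interiorS UP).
apply: subset_closure => Ul.
have [d ad] := Uat (shiftop T l) (csh l) Ul.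
have cl : continuous (shiftop T l) := csh l.
have [r r0 hr] := punctured_neighbourhood cl (at_tud _ _ cl ad).
have same m : cn (l - m) < r -> P (shiftop T m) <-> P (shiftop T l).
  move=> lm; have [->//|ml] := eqVneq m l.
  have mE : shiftop T m = shiftop (shiftop T l) (m - l).
    by apply/funext => x; rewrite /shiftop scalerBl; zabel.
  have ml0 : m - l != 0 by rewrite subr_eq0.
  have mlr : cn (m - l) <= r by rewrite -cnN opprB ltW.
  have [kz cR ea eb] := hr _ ml0 mlr.
  have cS : continuous (shiftop (shiftop T l) (m - l)) by exact: shift_continuous.
  rewrite mE (PQ _ _ cS (qf_at _ _ cS (conj kz cR))) ea eb.
  by rewrite (PQ _ _ cl ad).
have [Pl|nPl] := pselect (P (shiftop T l)).
  have /clP[m [nPm lm]] : nbhs (l : R[i]^o) [set m | cn (l - m) < r].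
    by apply/nbhs_cnP; exists r.
  by apply: nPm; apply/same.
apply: intP; apply/nbhs_cnP; exists r => // m lm Pm; apply: nPl.
exact: (same m lm).1 Pm.
Qed.

End Boundary.

Theorem corollary3p3 (R : realType) (X : completeNormedModType R[i])
    (infX : infinite_dimensional X) (T : {linear X -> X})
    (contT : continuous T) :
  (boundary (sigma_BWplus T) `<=` boundary (sigma_TUD T) /\
   boundary (sigma_BW T) `<=` boundary (sigma_TUD T) /\
   boundary (sigma_LDe T) `<=` boundary (sigma_TUD T) /\
   boundary (sigma_dsce T) `<=` boundary (sigma_TUD T) /\
   boundary (sigma_BPhi T) `<=` boundary (sigma_TUD T) /\
   boundary (sigma_LD T) `<=` boundary (sigma_TUD T) /\
   boundary (sigma_dsc T) `<=` boundary (sigma_TUD T) /\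
   boundary (sigma_D T) `<=` boundary (sigma_TUD T)) /\
  (boundary (sigma_BWminus T) `<=` boundary (sigma_qPhi T) /\
   boundary (sigma_RD T) `<=` boundary (sigma_qPhi T) /\
   boundary (sigma_RDe T) `<=` boundary (sigma_qPhi T)).
Proof.
have tudB (P : (X -> X) -> Prop) Q :
    (forall (S : {linear X -> X}) d, continuous S -> tud_at S d ->
       P S <-> Q (alpha S d) (beta S d)) ->
    (forall S : {linear X -> X}, continuous S -> P S -> TUD S) ->
    boundary (spectrum_of P T) `<=` boundary (sigma_TUD T).
  move=> PQ PU.
  apply: (@boundary_sub _ _ P (@TUD R X) (@tud_at R X) Q _ _ _ PQ PU T contT).
  - by move=> S _ /TUDP.
  - by [].
  - by move=> S d cS [kd cR]; exact: quasi_fredholm_tud.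
have qfB (P : (X -> X) -> Prop) Q :
    (forall (S : {linear X -> X}) d, continuous S -> quasi_fredholm_at S d ->
       P S <-> Q (alpha S d) (beta S d)) ->
    (forall S : {linear X -> X}, continuous S -> P S -> quasi_fredholm S) ->
    boundary (spectrum_of P T) `<=` boundary (sigma_qPhi T).
  move=> PQ PU.
  apply: (@boundary_sub _ _ P (@quasi_fredholm R X) quasi_fredholm_at Q
            _ _ _ PQ PU T contT).
  - by move=> S _ [d [kd cR]]; exists d.
  - by move=> S d cS [kd cR]; exact: quasi_fredholm_tud.
  - by [].
split; [split; [|split; [|split; [|split; [|split; [|split; [|split]]]]]]
       |split; [|split]].
- apply: (tudB _ (fun a b => a <> None /\ (enat a - enat b <= 0)%E)).
    by move=> S d cS td; apply: upper_semi_B_weylE => //; case: td.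
  by move=> S cS [/(upper_semi_B_fredholm_qf cS)/(quasi_fredholm_TUD cS)].
- apply: (tudB _ (fun a b => (a <> None /\ b <> None) /\ (enat a - enat b = 0)%E)).
    by move=> S d cS td; apply: B_weylE => //; case: td.
  by move=> S cS [/(B_fredholm_qf cS)/(quasi_fredholm_TUD cS)].
- apply: (tudB _ (fun a b => a <> None)).
    by move=> S d cS td; apply: left_ess_drazinE => //; case: td.
  by move=> S cS /(left_ess_drazin_qf cS)/(quasi_fredholm_TUD cS).
- apply: (tudB _ (fun a b => b <> None)).
    by move=> S d cS [kd _]; exact: finite_ess_descentE.
  by move=> S cS; exact: finite_ess_descent_TUD.
- apply: (tudB _ (fun a b => a <> None /\ b <> None)).
    by move=> S d cS td; apply: B_fredholmE => //; case: td.
  by move=> S cS /(B_fredholm_qf cS)/(quasi_fredholm_TUD cS).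
- apply: (tudB _ (fun a b => a = Some 0%N)).
    by move=> S d cS td; apply: left_drazinE => //; case: td.
  by move=> S cS /(left_drazin_qf cS)/(quasi_fredholm_TUD cS).
- apply: (tudB _ (fun a b => b = Some 0%N)).
    by move=> S d cS [kd _]; exact: finite_descentE.
  by move=> S cS; exact: finite_descent_TUD.
- apply: (tudB _ (fun a b => a = Some 0%N /\ b = Some 0%N)).
    by move=> S d cS [kd _]; exact: drazinE.
  by move=> S cS [_ /(finite_descent_TUD cS)].
- apply: (qfB _ (fun a b => b <> None /\ (0 <= enat a - enat b)%E)).
    by move=> S d cS [kd cR]; exact: lower_semi_B_weylE.
  by move=> S cS [/(lower_semi_B_fredholm_qf cS)].
- apply: (qfB _ (fun a b => b = Some 0%N)).
    by move=> S d cS [kd cR]; exact: right_drazinE.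
  by move=> S cS; exact: right_drazin_qf.
- apply: (qfB _ (fun a b => b <> None)).
    by move=> S d cS [kd cR]; exact: right_ess_drazinE.
  by move=> S cS; exact: right_ess_drazin_qf.
Qed.
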